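(* Let $s,t\ge 0$ with $s+t=1$, and let $\theta\in\mathbb{R}$ satisfy $$\inf_{q\in\mathbb{N}} q^{1/s}\|q\theta\|>0,$$ where, when $s=0$, the left-hand side is understood to be $+\infty$ (so the condition is vacuous). Then the set $\mathrm{Bad}(s,t;\theta)=\{y\in\mathbb{R}:(\theta,y)\in\mathrm{Bad}(s,t)\}$ is $\tfrac12$-winning (for Schmidt's game on $\mathbb{R}$).
   Context: For $x\in\mathbb{R}$, $\|x\|$ denotes the distance from $x$ to the nearest integer. For nonnegative $s,t$ with $s+t=1$, $\mathrm{Bad}(s,t)=\{(x_1,x_2)\in\mathbb{R}^2:\inf_{q\in\mathbb{N}}\max\{q^{s}\|qx_1\|,q^{t}\|qx_2\|\}>0\}$. Schmidt's game on a complete metric space $X$ with parameters $\alpha,\beta\in(0,1)$: Bob chooses a closed ball $B_0$; after $B_n$ is chosen, Alice chooses a closed ball $A_n\subset B_n$ of radius $\alpha$ times the radius of $B_n$, then Bob chooses a closed ball $B_{n+1}\subset A_n$ of radius $\beta$ times the radius of $A_n$. A set $Y\subset X$ is $(\alpha,\beta)$-winning if Alice has a strategy guaranteeing that the unique point of $\bigcap_n A_n$ lies in $Y$, and $\alpha$-winning if it is $(\alpha,\beta)$-winning for every $\beta\in(0,1)$. Here $X=\mathbb{R}$, so balls are compact intervals. *)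

(* Defs.v *)
From Stdlib Require Import Reals Lra List.
Import ListNotations.
Open Scope R_scope.

Definition dist_nint (x : R) : R := Rmin (frac_part x) (1 - frac_part x).

Definition Bad (s t x1 x2 : R) : Prop :=
  exists c : R, 0 < c /\
    forall q : nat, (1 <= q)%nat ->
      c <= Rmax (Rpower (INR q) s * dist_nint (INR q * x1))
                (Rpower (INR q) t * dist_nint (INR q * x2)).

(* A closed ball (compact interval) in R, given as (center, radius). *)
Definition ball := (R * R)%type.
Definition in_ball (x : R) (b : ball) : Prop := Rabs (x - fst b) <= snd b.
Definition ball_sub (b b' : ball) : Prop :=
  forall x, in_ball x b -> in_ball x b'.

Definition hist (B : nat -> ball) (n : nat) : list ball := map B (seq 0 (S n)).

(* A strategy for Alice maps the history of Bob's balls B_0..B_n to A_n;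
   it is legal if A_n is contained in B_n and has radius alpha * radius(B_n). *)
Definition legal_strategy (alpha : R) (sigma : list ball -> ball) : Prop :=
  forall (h : list ball) (b : ball),
    ball_sub (sigma (h ++ [b])) b /\ snd (sigma (h ++ [b])) = alpha * snd b.

Definition winning_ab (alpha beta : R) (Y : R -> Prop) : Prop :=
  exists sigma : list ball -> ball,
    legal_strategy alpha sigma /\
    forall B : nat -> ball,
      0 < snd (B 0%nat) ->
      (forall n : nat,
          ball_sub (B (S n)) (sigma (hist B n)) /\
          snd (B (S n)) = beta * snd (sigma (hist B n))) ->
      forall x : R, (forall n : nat, in_ball x (sigma (hist B n))) -> Y x.

Definition alpha_winning (alpha : R) (Y : R -> Prop) : Prop :=
  forall beta : R, 0 < beta < 1 -> winning_ab alpha beta Y.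

(* Main.v *)
(** Argue by points and lines, after Badziahin-Pollington-Velani and An.  A point
    [y] is bad unless some [P = (p/q, r/q)] comes within [c q^(-1-s)], [c q^(-1-t)] of
    [(theta, y)].  By pigeonhole [P] lies on a line [A x + B y + C = 0] with
    [|A| <= q^s], [|B| <= q^t]; the hypothesis on [theta] forces [B <> 0].  Put
    [K = q^t / B >= 1].  The dangerous interval around [P] lies within [2c/H] of the
    point of the line above [theta], with [H = q B], and [P] is handled when the radius
    of Bob's ball is about [K^(t/2) / H].

    Take two such points of the same stage and with comparable [K].  If [K] is bounded,
    each lies on the line of the other, so their intervals are close.  If [K] is large
    and the lines differ, they meet in a rational point of smaller denominator whose
    dangerous interval contains the whole of Bob's ball; this cannot happen for the smallest
    [q] endangering [y].  So each stage [n] yields one obstacle of size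
    [lambda^(-n-k)] for each logarithmic range [k] of [K].  As an obstacle of size
    [lambda^(-n-k)] may be dealt with over [k] moves, Alice evades them all by always
    playing the half of Bob's ball of smaller exponentially weighted count. *)

Require Import Defs.
From Stdlib Require Import Reals ZArith Arith Lra Lia List Classical ClassicalEpsilon.
Open Scope R_scope.

(** * Avoiding obstacles in the game *)

Lemma ball_sub_dist (b' b : ball) :
  0 <= snd b' -> ball_sub b' b -> Rabs (fst b' - fst b) <= snd b - snd b'.
Proof.
  intros H0 Hs.
  assert (H1 : in_ball (fst b' + snd b') b).
  { apply Hs; unfold in_ball; rewrite Rabs_right; lra. }
  assert (H2 : in_ball (fst b' - snd b') b).
  { apply Hs; unfold in_ball; rewrite Rabs_left1; lra. }
  unfold in_ball in *. revert H1 H2. unfold Rabs.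
  repeat destruct Rcase_abs; lra.
Qed.

Definition half (sg : R) (b : ball) : ball := (fst b + sg * (snd b / 2), snd b / 2).

Lemma half_sub (sg : R) (b : ball) : sg = 1 \/ sg = -1 -> ball_sub (half sg b) b.
Proof.
  intros [-> | ->] x; unfold in_ball, half; simpl; unfold Rabs;
    repeat destruct Rcase_abs; lra.
Qed.

(* Value of the obstacle [z - r, z + r] against the ball [b].  Obstacles close to
   the centre, which neither half of [b] avoids, count for 3/2: after either choice
   they sit at the boundary. *)
Definition value (r z : R) (b : ball) : R :=
  if Rle_dec (Rabs (z - fst b)) r then 3 / 2
  else if Rle_dec (Rabs (z - fst b)) (snd b + r) then 1 else 0.

(** What an obstacle can be worth in Bob's next ball once Alice has taken the half on side [sg]: a
    central one stops being central, one on the chosen side may become central, one on the other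
    side is lost. *)
Definition cost (sg r z : R) (b : ball) : R :=
  if Rle_dec (Rabs (z - fst b)) r then 1
  else if Rle_dec (Rabs (z - fst b)) (snd b + r) then
    (if Rlt_dec 0 (sg * (z - fst b)) then 3 / 2 else 0)
  else 0.

Lemma value_bounds (r z : R) (b : ball) : 0 <= value r z b <= 3 / 2.
Proof. unfold value; repeat destruct Rle_dec; lra. Qed.

(** As [b'] lies in a half of [b], its centre is at least its own radius, hence more than [2 * r],
    away from the centre of [b]. So a central obstacle cannot stay central. *)
Lemma value_le_cost (sg r z : R) (b b' : ball) :
  sg = 1 \/ sg = -1 -> 0 <= r -> 2 * r < snd b' -> ball_sub b' (half sg b) ->
  value r z b' <= cost sg r z b.
Proof.
  intros Hsg Hr Hb' Hs.
  apply ball_sub_dist in Hs; [| lra].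
  unfold half in Hs; simpl in Hs.
  unfold value, cost; destruct Hsg as [-> | ->];
  repeat destruct Rle_dec; repeat destruct Rlt_dec; try lra;
  exfalso; revert Hs; repeat match goal with
    | H : Rabs _ <= _ |- _ => revert H
    | H : ~ (Rabs _ <= _) |- _ => revert H end;
  unfold Rabs; repeat destruct Rcase_abs; intros; lra.
Qed.

(** A central obstacle gives [1 + 1 <= 3/2 * 3/2], an off-centre one [3/2 + 0 <= 3/2 * 1]. The
    better half thus keeps at most 3/4 of the value. *)
Lemma cost_sum (r z : R) (b : ball) :
  cost 1 r z b + cost (-1) r z b <= 3 / 2 * value r z b.
Proof.
  unfold value, cost; repeat destruct Rle_dec; repeat destruct Rlt_dec; try lra.
Qed.

Lemma value_pos_of_point (r z x : R) (b : ball) :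
  in_ball x b -> Rabs (x - z) <= r -> 1 <= value r z b.
Proof.
  unfold in_ball, value; intros H1 H2.
  repeat destruct Rle_dec; try lra.
  exfalso; revert n0 H1 H2; unfold Rabs; repeat destruct Rcase_abs; intros; lra.
Qed.

(* 41 makes the obstacles introduced at one stage weigh at most 1/14 in total, which
   with the decay factor 6/7 of a move keeps the potential below 1/2. *)
Definition delay : nat := 41.

(** Obstacle [(n, k)] appears with ball [n] and has deadline [n + k + delay]. Its weight grows by
    8/7 per move, equals 1 at the last move before the deadline, and vanishes from then on. *)
Definition weight (m n k : nat) : R :=
  if le_lt_dec (n + k + delay) m then 0 else (7 / 8) ^ (n + k + delay - 1 - m).

Definition pot (f : R -> R -> ball -> R) (r : nat -> R) (z : nat -> nat -> R)
    (m : nat) (b : ball) : R :=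
  sum_f_R0 (fun n => sum_f_R0 (fun k => weight m n k * f (r (n + k + delay)%nat) (z n k) b) n) m.

Lemma weight_nonneg (m n k : nat) : 0 <= weight m n k.
Proof.
  unfold weight; destruct le_lt_dec; [lra | apply pow_le; lra].
Qed.

Lemma weight_S (m n k : nat) : (m + 1 < n + k + delay)%nat ->
  weight (S m) n k = 8 / 7 * weight m n k.
Proof.
  intros H; unfold weight; do 2 (destruct le_lt_dec; [lia |]).
  replace (n + k + delay - 1 - m)%nat with (S (n + k + delay - 1 - S m)) by lia.
  simpl; lra.
Qed.

Lemma weight_S_expired (m n k : nat) : (n + k + delay <= m + 1)%nat -> weight (S m) n k = 0.
Proof. intros H; unfold weight; destruct le_lt_dec; [reflexivity | lia]. Qed.

Lemma pot_ext (f : R -> R -> ball -> R) (r : nat -> R) (z z' : nat -> nat -> R) (m : nat) (b : ball) :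
  (forall n k, (n <= m)%nat -> z n k = z' n k) -> pot f r z m b = pot f r z' m b.
Proof.
  intros H; unfold pot; apply sum_eq; intros n Hn; apply sum_eq; intros k Hk.
  now rewrite H.
Qed.

Lemma pot_cost_sum (r : nat -> R) (z : nat -> nat -> R) (m : nat) (b : ball) :
  pot (cost 1) r z m b + pot (cost (-1)) r z m b <= 3 / 2 * pot value r z m b.
Proof.
  unfold pot; rewrite scal_sum, <- sum_plus; apply sum_Rle; intros n Hn.
  rewrite <- sum_plus, Rmult_comm, scal_sum; apply sum_Rle; intros k Hk.
  pose proof (cost_sum (r (n + k + delay)%nat) (z n k) b).
  pose proof (weight_nonneg m n k). nra.
Qed.

Lemma sum_new_weights (m n : nat) :
  sum_f_R0 (fun k => weight m m k * (3 / 2)) n <= 1 / 14.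
Proof.
  (* A geometric series of ratio 7/8: the total is at most [12 * (7/8)^40], and [168 = 12 * 14]. *)
  assert (H : forall j, sum_f_R0 (fun k => weight m m k * (3 / 2)) j =
      (3 / 2 * (7 / 8) ^ (delay - 1)) * (8 * (1 - (7 / 8) ^ S j))).
  { assert (Hw : forall k, weight m m k = (7 / 8) ^ (delay - 1) * (7 / 8) ^ k).
    { intros k; unfold weight; destruct le_lt_dec; [unfold delay in *; lia |].
      rewrite <- pow_add; f_equal; unfold delay; lia. }
    intros j; induction j as [| j IH].
    - simpl sum_f_R0; rewrite Hw; simpl; lra.
    - simpl sum_f_R0; rewrite IH, Hw.
      change ((7 / 8) ^ S (S j)) with (7 / 8 * (7 / 8) ^ S j). lra. }
  rewrite H.
  assert (0 <= (7 / 8) ^ S n) by (apply pow_le; lra).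
  assert ((7 / 8) ^ (delay - 1) <= 1 / 168).
  { unfold delay; change (41 - 1)%nat with 40%nat; lra. }
  assert (0 <= (7 / 8) ^ (delay - 1)) by (apply pow_le; lra).
  nra.
Qed.

(** A move multiplies the live weights by 8/7 and adds the obstacles of the new ball. Expired
    obstacles have weight 0, so radii need control only for [m + 1 < j]. *)
Lemma pot_step (sg : R) (r : nat -> R) (z : nat -> nat -> R) (m : nat) (b b' : ball) :
  sg = 1 \/ sg = -1 -> (forall j, 0 <= r j) ->
  (forall j, (m + 1 < j)%nat -> 2 * r j < snd b') -> ball_sub b' (half sg b) ->
  pot value r z (S m) b' <= 8 / 7 * pot (cost sg) r z m b + 1 / 14.
Proof.
  intros Hsg Hr0 Hr Hb; unfold pot at 1; rewrite tech5.
  apply Rplus_le_compat.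
  - unfold pot; rewrite scal_sum; apply sum_Rle; intros n Hn.
    rewrite Rmult_comm, scal_sum; apply sum_Rle; intros k Hk.
    destruct (le_lt_dec (n + k + delay) (m + 1)) as [H | H].
    + rewrite weight_S_expired by exact H.
      assert (0 <= cost sg (r (n + k + delay)%nat) (z n k) b).
      { unfold cost; repeat destruct Rle_dec; repeat destruct Rlt_dec; lra. }
      pose proof (weight_nonneg m n k). nra.
    + rewrite weight_S by exact H.
      pose proof (value_le_cost sg _ (z n k) b b' Hsg (Hr0 _) (Hr _ H) Hb).
      pose proof (weight_nonneg m n k). nra.
  - eapply Rle_trans; [| apply (sum_new_weights (S m) (S m))].
    apply sum_Rle; intros k Hk. apply Rmult_le_compat_l; [apply weight_nonneg |].
    apply value_bounds.
Qed.

Lemma pot_ge_term (r : nat -> R) (z : nat -> nat -> R) (m n k : nat) (b : ball) :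
  (n <= m)%nat -> (k <= n)%nat ->
  weight m n k * value (r (n + k + delay)%nat) (z n k) b <= pot value r z m b.
Proof.
  assert (Hsum : forall (f : nat -> R) (N i : nat), (forall j, 0 <= f j) -> (i <= N)%nat ->
      f i <= sum_f_R0 f N).
  { intros f N i Hf; induction N as [| N IH]; intros Hi.
    - replace i with 0%nat by lia; simpl; lra.
    - rewrite tech5; destruct (Nat.eq_dec i (S N)) as [-> | Hne].
      + pose proof (cond_pos_sum f N Hf); lra.
      + specialize (IH ltac:(lia)); pose proof (Hf (S N)); lra. }
  intros Hn Hk; unfold pot.
  assert (Hpos : forall n0 k0, 0 <= weight m n0 k0 * value (r (n0 + k0 + delay)%nat) (z n0 k0) b).
  { intros; apply Rmult_le_pos; [apply weight_nonneg | apply value_bounds]. }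
  eapply Rle_trans;
    [apply (Hsum (fun k => weight m n k * value (r (n + k + delay)%nat) (z n k) b) n k) |
     apply (Hsum (fun n => sum_f_R0 (fun k => weight m n k * value (r (n + k + delay)%nat) (z n k) b) n) m n)];
    auto.
  intros; apply cond_pos_sum; auto.
Qed.

(** Alice takes the half of smaller cost potential. This keeps the potential at most 1/2, by
    [8/7 * 3/4 * 1/2 + 1/14 = 1/2], whereas an obstacle hit just before its deadline would alone
    contribute at least 1. The centres depend only on Bob's first radius and the ball of their
    stage, so the history determines them. *)
Lemma avoid_obstacles (beta : R) (zf : R -> ball -> nat -> R) (Y : R -> Prop) :
  0 < beta < 1 ->
  (forall (B : nat -> ball) (x : R), 0 < snd (B 0%nat) ->
     (forall n, snd (B n) = snd (B 0%nat) * (beta / 2) ^ n) ->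
     (forall n, in_ball x (B n)) ->
     (forall n k, (k <= n)%nat ->
        snd (B 0%nat) * (beta / 2) ^ (n + k + delay) < Rabs (x - zf (snd (B 0%nat)) (B n) k)) ->
     Y x) ->
  winning_ab (1 / 2) beta Y.
Proof.
  intros Hbeta HY.
  (* A history of length [m + 1] ends with ball [m], hence [length H - 1] below; the default [d] is
     never read in an actual play. *)
  set (d := ((0, 0) : ball)).
  set (zz := fun (H : list ball) n k => zf (snd (nth 0 H d)) (nth n H d) k).
  set (rr := fun (H : list ball) j => snd (nth 0 H d) * (beta / 2) ^ j).
  set (side := fun H : list ball =>
    if Rle_dec (pot (cost 1) (rr H) (zz H) (length H - 1) (last H d))
               (pot (cost (-1)) (rr H) (zz H) (length H - 1) (last H d)) then 1 else -1).
  assert (Hside : forall H, side H = 1 \/ side H = -1).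
  { intros H; unfold side; destruct Rle_dec; auto. }
  exists (fun H => half (side H) (last H d)). split.
  { intros h b; rewrite last_last; split; [apply half_sub, Hside | simpl; lra]. }
  intros B HB0 Hplay x Hx.
  assert (Hlen : forall n, length (hist B n) = S n).
  { intros n; unfold hist; now rewrite length_map, length_seq. }
  assert (Hnth : forall m n, (n <= m)%nat -> nth n (hist B m) d = B n).
  { intros m n Hn; unfold hist.
    rewrite (nth_indep _ d (B 0%nat)) by (rewrite length_map, length_seq; lia).
    rewrite map_nth, seq_nth by lia; reflexivity. }
  assert (Hlast : forall n, last (hist B n) d = B n).
  { intros n; unfold hist; rewrite seq_S, map_app; simpl; now rewrite last_last. }
  assert (Hrad : forall n, snd (B n) = snd (B 0%nat) * (beta / 2) ^ n).
  { induction n as [| n IH]; [simpl; lra |].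
    destruct (Hplay n) as [_ ->]; unfold half; cbn [snd]; rewrite Hlast, IH; simpl; lra. }
  assert (HxB : forall n, in_ball x (B n)).
  { intros n; specialize (Hx n); rewrite Hlast in Hx. exact (half_sub _ _ (Hside _) x Hx). }
  apply (HY B x HB0 Hrad HxB).
  set (r := fun j => snd (B 0%nat) * (beta / 2) ^ j).
  set (z := fun n k => zf (snd (B 0%nat)) (B n) k).
  assert (Hr0 : forall j, 0 < r j).
  { intros j; apply Rmult_lt_0_compat; [lra | apply pow_lt; lra]. }
  assert (Hpot : forall m, pot value r z m (B m) <= 1 / 2).
  { induction m as [| m IH].
    - unfold pot; cbn [sum_f_R0].
      pose proof (sum_new_weights 0 0) as H; cbn [sum_f_R0] in H.
      pose proof (weight_nonneg 0 0 0).
      pose proof (value_bounds (r (0 + 0 + delay)%nat) (z 0%nat 0%nat) (B 0%nat)). nra.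
    - destruct (Hplay m) as [Hsub _]; rewrite Hlast in Hsub.
      assert (Hstep := pot_step (side (hist B m)) r z m (B m) (B (S m)) (Hside _)
        (fun j => Rlt_le _ _ (Hr0 j))).
      assert (Hr : forall j, (m + 1 < j)%nat -> 2 * r j < snd (B (S m))).
      { intros j Hj; rewrite Hrad; unfold r.
        replace j with (S m + S (j - m - 2))%nat by lia; rewrite pow_add.
        assert (0 < (beta / 2) ^ S m) by (apply pow_lt; lra).
        assert ((beta / 2) ^ (j - m - 2) <= 1).
        { rewrite <- (pow1 (j - m - 2)); apply pow_incr; lra. }
        assert (0 < (beta / 2) ^ (j - m - 2)) by (apply pow_lt; lra).
        assert (2 * (beta / 2) ^ S (j - m - 2) < 1) by (simpl; nra).
        assert (0 < snd (B 0%nat) * (beta / 2) ^ S m) by nra.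
        nra. }
      specialize (Hstep Hr Hsub).
      assert (Hc := pot_cost_sum r z m (B m)).
      assert (Hmin : 2 * pot (cost (side (hist B m))) r z m (B m) <=
                     pot (cost 1) r z m (B m) + pot (cost (-1)) r z m (B m)).
      { assert (E : forall sg, pot (cost sg) (rr (hist B m)) (zz (hist B m))
            (length (hist B m) - 1) (last (hist B m) d) = pot (cost sg) r z m (B m)).
        { intros sg; rewrite Hlast, Hlen; replace (S m - 1)%nat with m by lia.
          unfold rr; rewrite Hnth by lia; apply pot_ext.
          intros n k Hn; unfold zz, z; rewrite !Hnth by lia; reflexivity. }
        unfold side; rewrite !E; destruct Rle_dec; lra. }
      lra. }
  intros n k Hk; apply Rnot_le_lt; intros Hle.
  (* The last move before the deadline of [(n, k)], where its weight is 1. *)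
  set (m := (n + k + delay - 1)%nat).
  assert (Hv := value_pos_of_point _ _ _ _ (HxB m) Hle).
  assert (Ht := pot_ge_term r z m n k (B m) ltac:(unfold m, delay; lia) Hk).
  assert (Hw : weight m n k = 1).
  { unfold weight, m; destruct le_lt_dec; [unfold delay in *; lia |].
    rewrite Nat.sub_diag; reflexivity. }
  specialize (Hpot m); unfold r at 1, z at 1 in Ht. rewrite Hw in Ht. lra.
Qed.

(** * Rational points near the fibre and lines through them *)

Lemma dist_nint_le (x : R) (p : Z) : dist_nint x <= Rabs (x - IZR p).
Proof.
  unfold dist_nint, frac_part; destruct (base_Int_part x) as [H1 H2].
  destruct (Z_le_gt_dec p (Int_part x)) as [H | H].
  - apply IZR_le in H. eapply Rle_trans; [apply Rmin_l |]. rewrite Rabs_right; lra.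
  - assert (H' : (Int_part x + 1 <= p)%Z) by lia.
    apply IZR_le in H'; rewrite plus_IZR in H'.
    eapply Rle_trans; [apply Rmin_r |]. rewrite Rabs_left1; lra.
Qed.

Lemma dist_nint_attained (x : R) : exists p : Z, Rabs (x - IZR p) = dist_nint x.
Proof.
  unfold dist_nint, frac_part; destruct (base_Int_part x) as [H1 H2].
  unfold Rmin; destruct Rle_dec.
  - exists (Int_part x); apply Rabs_right; lra.
  - exists (Int_part x + 1)%Z; rewrite plus_IZR, Rabs_left1; lra.
Qed.

Lemma pigeonhole_mod (N : nat) (f : nat -> Z) (q : Z) :
  (0 < q < Z.of_nat N)%Z ->
  exists i j : nat, (i < j < N)%nat /\ (f i mod q = f j mod q)%Z.
Proof.
  intros Hq; apply NNPP; intros Hn.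
  set (l := map (fun i => Z.to_nat (f i mod q)) (seq 0 N)).
  assert (Hnd : NoDup l).
  { unfold l; apply NoDup_map_NoDup_ForallPairs; [| apply seq_NoDup].
    intros i j Hi Hj E; rewrite in_seq in Hi, Hj.
    apply Z2Nat.inj in E; try (apply Z.mod_pos_bound; lia).
    destruct (Nat.lt_trichotomy i j) as [H | [H | H]]; auto; exfalso; apply Hn;
      [exists i, j | exists j, i]; split; auto; lia. }
  assert (Hincl : incl l (seq 0 (Z.to_nat q))).
  { intros a Ha; unfold l in Ha; apply in_map_iff in Ha; destruct Ha as [i [<- _]].
    apply in_seq; assert (H := Z.mod_pos_bound (f i) q ltac:(lia)); lia. }
  apply NoDup_incl_length in Hincl; auto.
  unfold l in Hincl; rewrite length_map, !length_seq in Hincl; lia.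
Qed.

Definition near (s t theta c : R) (q p r : Z) (y : R) : Prop :=
  (1 <= q)%Z /\
  Rpower (IZR q) s * Rabs (IZR q * theta - IZR p) < c /\
  Rpower (IZR q) t * Rabs (IZR q * y - IZR r) < c.

Definition on_line (s t : R) (q p r A B C : Z) : Prop :=
  (A * p + B * r + C * q = 0)%Z /\ (1 <= B)%Z /\
  Rabs (IZR A) <= Rpower (IZR q) s /\ IZR B <= Rpower (IZR q) t.

Lemma Rpower_ge_1 (x a : R) : 1 <= x -> 0 <= a -> 1 <= Rpower x a.
Proof.
  intros Hx Ha; rewrite <- (Rpower_O x) by lra; apply Rle_Rpower; lra.
Qed.

(** Among the more than [q] integer pairs [(u, v)] with [0 <= u <= q^s] and [0 <= v <= q^t], two
    give the same [u p + v r] modulo [q]. Their difference, up to sign, is [(A, B)]. *)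
Lemma line_through (s t : R) (q p r : Z) :
  0 <= s -> 0 <= t -> s + t = 1 -> (1 <= q)%Z ->
  exists A B C : Z, (A * p + B * r + C * q = 0)%Z /\ (A <> 0 \/ B <> 0)%Z /\
    (0 <= B)%Z /\
    Rabs (IZR A) <= Rpower (IZR q) s /\ IZR B <= Rpower (IZR q) t.
Proof.
  intros Hs Ht Hst Hq.
  assert (Hq1 : 1 <= IZR q) by (apply (IZR_le 1); lia).
  set (fl := fun u => Int_part (Rpower (IZR q) u)).
  assert (Hfl : forall u, 0 <= u -> (1 <= fl u)%Z /\ IZR (fl u) <= Rpower (IZR q) u
            /\ Rpower (IZR q) u < IZR (fl u + 1)).
  { intros u Hu; unfold fl; destruct (base_Int_part (Rpower (IZR q) u)) as [H1 H2].
    rewrite plus_IZR; repeat split; try lra.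
    assert (H := Rpower_ge_1 _ _ Hq1 Hu).
    assert (0 < Int_part (Rpower (IZR q) u))%Z; [| lia]. apply lt_IZR; lra. }
  destruct (Hfl s Hs) as [Hs1 [Hs2 Hs3]], (Hfl t Ht) as [Ht1 [Ht2 Ht3]].
  set (a := fl s) in *; set (b := fl t) in *.
  set (N := Z.to_nat ((a + 1) * (b + 1))).
  assert (HqN : (q < (a + 1) * (b + 1))%Z).
  { apply lt_IZR; rewrite mult_IZR.
    rewrite <- (Rpower_1 (IZR q)) by lra; rewrite <- Hst, Rpower_plus.
    apply Rmult_le_0_lt_compat; auto; left; apply exp_pos. }
  (* Quotient and remainder by [b + 1] enumerate the pairs. *)
  set (u := fun i : nat => (Z.of_nat i / (b + 1))%Z).
  set (v := fun i : nat => (Z.of_nat i mod (b + 1))%Z).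
  destruct (pigeonhole_mod N (fun i => u i * p + v i * r)%Z q) as [i [j [Hij E]]]; [unfold N; lia |].
  assert (Hu : forall k, (k < N)%nat -> (0 <= u k <= a)%Z).
  { intros k Hk; unfold u; split; [apply Z.div_pos; lia |].
    assert (Z.of_nat k / (b + 1) < a + 1)%Z; [| lia].
    apply Z.div_lt_upper_bound; unfold N in Hk; lia. }
  assert (Hv : forall k, (0 <= v k <= b)%Z).
  { intros k; unfold v; assert (H := Z.mod_pos_bound (Z.of_nat k) (b + 1) ltac:(lia)); lia. }
  assert (Hdiv : exists C, ((u i - u j) * p + (v i - v j) * r + C * q = 0)%Z).
  { exists ((u j * p + v j * r) / q - (u i * p + v i * r) / q)%Z.
    assert (E1 := Z.div_mod (u i * p + v i * r) q ltac:(lia)).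
    assert (E2 := Z.div_mod (u j * p + v j * r) q ltac:(lia)). nia. }
  destruct Hdiv as [C HC].
  assert (Hne : (u i - u j <> 0 \/ v i - v j <> 0)%Z).
  { apply NNPP; intros Hn.
    assert (E1 := Z.div_mod (Z.of_nat i) (b + 1) ltac:(lia)).
    assert (E2 := Z.div_mod (Z.of_nat j) (b + 1) ltac:(lia)).
    fold (u i) (v i) in E1; fold (u j) (v j) in E2.
    assert (u i = u j) by lia; assert (v i = v j) by lia. nia. }
  assert (Hui := Hu i ltac:(lia)); assert (Huj := Hu j ltac:(lia)).
  assert (Hvi := Hv i); assert (Hvj := Hv j).
  assert (HA : forall x, (- a <= x <= a)%Z -> Rabs (IZR x) <= Rpower (IZR q) s).
  { intros x [Hx1 Hx2]; apply IZR_le in Hx1, Hx2; rewrite opp_IZR in Hx1.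
    apply Rabs_le; lra. }
  destruct (Z_le_gt_dec 0 (v i - v j)) as [Hsg | Hsg].
  - exists (u i - u j)%Z, (v i - v j)%Z, C; repeat split; auto.
    + apply HA; lia.
    + eapply Rle_trans; [| exact Ht2]; apply IZR_le; lia.
  - exists (u j - u i)%Z, (v j - v i)%Z, (- C)%Z; repeat split; try lia.
    + apply HA; lia.
    + eapply Rle_trans; [| exact Ht2]; apply IZR_le; lia.
Qed.

Lemma Rpower_inv_le (x q s : R) : 0 < s -> 0 < x -> 0 < q -> x <= Rpower q s ->
  Rpower x (1 / s) <= q.
Proof.
  intros Hs Hx Hq H.
  rewrite <- (Rpower_1 q) by exact Hq.
  replace 1 with (s * (1 / s)) at 2 by (field; lra).
  rewrite <- Rpower_mult; apply Rle_Rpower_l; [| lra].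
  left; apply Rdiv_lt_0_compat; lra.
Qed.

(* The hypothesis on [theta] rules out vertical lines. *)
Lemma line_exists (s t theta c c0 : R) (q p r : Z) (y : R) :
  0 <= s -> 0 <= t -> s + t = 1 ->
  (s = 0 \/ forall q : nat, (1 <= q)%nat ->
         c0 <= Rpower (INR q) (1 / s) * dist_nint (INR q * theta)) ->
  c <= c0 -> near s t theta c q p r y ->
  exists A B C : Z, on_line s t q p r A B C.
Proof.
  intros Hs Ht Hst Hth Hc [Hq [Hnx _]].
  assert (Hq1 : 1 <= IZR q) by (apply (IZR_le 1); lia).
  destruct (Req_dec s 0) as [-> | Hs0].
  (* For [s = 0] the hypothesis is vacuous, and the horizontal line through the point works. *)
  { exists 0%Z, q, (- r)%Z; repeat split; try lia.
    - rewrite Rabs_R0; left; apply exp_pos.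
    - replace t with 1 by lra; rewrite Rpower_1 by lra; lra. }
  destruct Hth as [-> | Hth]; [lra |].
  destruct (line_through s t q p r Hs Ht Hst Hq) as [A [B [C [E [Hne [HB [HA HB']]]]]]].
  exists A, B, C; repeat split; auto.
  (* If [B = 0] then [q |A theta + C| = |A| |q theta - p| < c], while [|A|^(1/s) <= q]; so [|A|]
     violates the hypothesis on [theta]. *)
  destruct (Z.eq_dec B 0) as [-> | HB0]; [exfalso | lia].
  destruct Hne as [HA0 | ]; [| lia].
  specialize (Hth (Z.abs_nat A) ltac:(lia)).
  rewrite INR_IZR_INZ, Zabs2Nat.id_abs, abs_IZR in Hth.
  assert (HA1 : 1 <= Rabs (IZR A)) by (rewrite <- abs_IZR; apply (IZR_le 1); lia).
  assert (Hpow := Rpower_inv_le (Rabs (IZR A)) (IZR q) s ltac:(lra) ltac:(lra) ltac:(lra) HA).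
  assert (Hd : dist_nint (Rabs (IZR A) * theta) <= Rabs (IZR A * theta + IZR C)).
  { destruct (Z_le_gt_dec 0 A) as [H | H].
    - apply IZR_le in H; rewrite Rabs_right by lra.
      eapply Rle_trans; [apply (dist_nint_le _ (- C)) |]; rewrite opp_IZR.
      right; f_equal; lra.
    - assert (IZR A < 0) by (apply IZR_lt; lia); rewrite Rabs_left by lra.
      eapply Rle_trans; [apply (dist_nint_le _ C) |].
      right; rewrite <- Rabs_Ropp; f_equal; lra. }
  assert (EF : IZR q * (IZR A * theta + IZR C) = IZR A * (IZR q * theta - IZR p)).
  { assert (IZR A * IZR p + IZR C * IZR q = 0); [| lra].
    rewrite <- !mult_IZR, <- plus_IZR; f_equal; lia. }
  apply (f_equal Rabs) in EF; rewrite !Rabs_mult, (Rabs_right (IZR q)) in EF by lra.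
  assert (H0 := Rabs_pos (IZR A * theta + IZR C)).
  assert (H1 := Rabs_pos (IZR q * theta - IZR p)).
  assert (H2 : 0 < Rpower (Rabs (IZR A)) (1 / s)) by apply exp_pos.
  nra.
Qed.

(** * Two points of the same stage *)

Lemma Zeq_IZR (a b : Z) : a = b -> IZR a = IZR b.
Proof. now intros ->. Qed.

Lemma Rabs_triang_le (a b x y : R) : Rabs a <= x -> Rabs b <= y -> Rabs (a + b) <= x + y.
Proof. intros; eapply Rle_trans; [apply Rabs_triang | lra]. Qed.

Lemma Rabs_mult_le (a b x y : R) : Rabs a <= x -> Rabs b <= y -> Rabs (a * b) <= x * y.
Proof.
  intros; rewrite Rabs_mult; apply Rmult_le_compat; auto using Rabs_pos.
Qed.

Lemma Rabs_IZR_lt_1 (n : Z) : Rabs (IZR n) < 1 -> n = 0%Z.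
Proof.
  rewrite <- abs_IZR; intros H; apply lt_IZR in H; lia.
Qed.

Lemma le_div_of_mul_lt (a b c : R) : 0 < b -> b * a < c -> a <= c / b.
Proof.
  intros Hb H; apply (Rmult_le_reg_l b); [exact Hb |]. field_simplify; lra.
Qed.

Lemma exp_le (a b : R) : a <= b -> exp a <= exp b.
Proof. intros [H | ->]; [left; now apply exp_increasing | right; reflexivity]. Qed.

Lemma Rpower_comparable (q q' M a : R) :
  0 < q -> 0 < q' -> 1 <= M -> q' <= M * q -> 0 <= a <= 1 ->
  Rpower q' a <= M * Rpower q a.
Proof.
  intros Hq Hq' HM H Ha.
  eapply Rle_trans; [apply (Rle_Rpower_l _ (M * q)); lra |].
  rewrite <- Rpower_mult_distr by lra.
  apply Rmult_le_compat_r; [left; apply exp_pos |].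
  rewrite <- (Rpower_1 M) at 2 by lra. apply Rle_Rpower; lra.
Qed.

Lemma near_x (s t theta c : R) (q p r : Z) (y : R) :
  near s t theta c q p r y -> Rabs (IZR q * theta - IZR p) <= c / Rpower (IZR q) s.
Proof.
  intros [Hq [H _]]; assert (0 < Rpower (IZR q) s) by apply exp_pos.
  now apply le_div_of_mul_lt.
Qed.

Lemma near_y (s t theta c : R) (q p r : Z) (y : R) :
  near s t theta c q p r y -> Rabs (IZR q * y - IZR r) <= c / Rpower (IZR q) t.
Proof.
  intros [Hq [_ H]]; assert (0 < Rpower (IZR q) t) by apply exp_pos.
  now apply le_div_of_mul_lt.
Qed.

(** As [(p/q, r/q)] is on the line, the form equals [(A (q theta - p) + B (q y - r)) / q], and the
    bounds on [A] and [B] make each term at most [c / q]. *)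
Lemma line_value (s t theta c : R) (q p r A B C : Z) (y : R) :
  near s t theta c q p r y -> on_line s t q p r A B C ->
  Rabs (IZR A * theta + IZR B * y + IZR C) <= 2 * c / IZR q.
Proof.
  intros Hn [E [HB [HA HB']]].
  assert (Hx := near_x _ _ _ _ _ _ _ _ Hn); assert (Hy := near_y _ _ _ _ _ _ _ _ Hn).
  destruct Hn as [Hq _]; apply (IZR_le 1) in Hq, HB.
  assert (0 < Rpower (IZR q) s) by apply exp_pos.
  assert (0 < Rpower (IZR q) t) by apply exp_pos.
  apply Zeq_IZR in E; rewrite !plus_IZR, !mult_IZR in E.
  assert (EC : IZR C = - (IZR A * IZR p + IZR B * IZR r) / IZR q).
  { apply (Rmult_eq_reg_r (IZR q)); [field_simplify |]; lra. }
  replace (IZR A * theta + IZR B * y + IZR C) with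
    ((IZR A * (IZR q * theta - IZR p) + IZR B * (IZR q * y - IZR r)) / IZR q)
    by (rewrite EC; field; lra).
  unfold Rdiv; rewrite Rabs_mult, (Rabs_right (/ IZR q)) by
    (left; apply Rinv_0_lt_compat; lra).
  apply Rmult_le_compat_r; [left; apply Rinv_0_lt_compat; lra |].
  assert (HB1 : Rabs (IZR B) <= Rpower (IZR q) t) by (rewrite Rabs_right; lra).
  eapply Rle_trans; [apply (Rabs_triang_le _ _ _ _ (Rabs_mult_le _ _ _ _ HA Hx)
     (Rabs_mult_le _ _ _ _ HB1 Hy)) |].
  right; field; lra.
Qed.

(** Both [y1] and [y2] are compared with the point of the common line above [theta], using
    [line_value] divided by [B]. *)
Lemma same_line_close (s t theta c : R) (q1 p1 r1 A1 B1 C1 q2 p2 r2 A2 B2 C2 : Z) (y1 y2 : R) :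
  near s t theta c q1 p1 r1 y1 -> on_line s t q1 p1 r1 A1 B1 C1 ->
  near s t theta c q2 p2 r2 y2 -> on_line s t q2 p2 r2 A2 B2 C2 ->
  (A1 * B2 = A2 * B1)%Z -> (B1 * C2 = B2 * C1)%Z ->
  Rabs (y1 - y2) <= 2 * c / (IZR q1 * IZR B1) + 2 * c / (IZR q2 * IZR B2).
Proof.
  intros Hn1 Hl1 Hn2 Hl2 EA EC.
  assert (H1 := line_value _ _ _ _ _ _ _ _ _ _ _ Hn1 Hl1).
  assert (H2 := line_value _ _ _ _ _ _ _ _ _ _ _ Hn2 Hl2).
  destruct Hn1 as [Hq1 _], Hn2 as [Hq2 _], Hl1 as [_ [HB1 _]], Hl2 as [_ [HB2 _]].
  apply (IZR_le 1) in Hq1, Hq2, HB1, HB2.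
  apply Zeq_IZR in EA, EC; rewrite !mult_IZR in EA, EC.
  assert (EA' : IZR A2 = IZR A1 * IZR B2 / IZR B1)
    by (apply (Rmult_eq_reg_r (IZR B1)); [field_simplify |]; lra).
  assert (EC' : IZR C2 = IZR B2 * IZR C1 / IZR B1)
    by (apply (Rmult_eq_reg_r (IZR B1)); [field_simplify |]; lra).
  assert (HI1 : 0 < / IZR B1) by (apply Rinv_0_lt_compat; lra).
  assert (HI2 : 0 < / IZR B2) by (apply Rinv_0_lt_compat; lra).
  replace (y1 - y2) with ((IZR A1 * theta + IZR B1 * y1 + IZR C1) * / IZR B1
    + - ((IZR A2 * theta + IZR B2 * y2 + IZR C2) * / IZR B2)).
  - apply Rabs_triang_le; rewrite ?Rabs_Ropp, Rabs_mult.
    + rewrite (Rabs_right (/ IZR B1)) by lra.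
      eapply Rle_trans; [apply Rmult_le_compat_r; [lra | exact H1] |].
      right; field; lra.
    + rewrite (Rabs_right (/ IZR B2)) by lra.
      eapply Rle_trans; [apply Rmult_le_compat_r; [lra | exact H2] |].
      right; field; lra.
  - rewrite EA', EC'; field; lra.
Qed.

(** An integer of absolute value below 1 vanishes. Expanding around [(theta, y2)] leaves errors
    [2cM], [cM], [cM] from nearness and [2 rho q1 B2] from the distance between [y1] and [y2]. *)
Lemma incident (s t theta c rho M : R) (q1 p1 r1 q2 p2 r2 A2 B2 C2 : Z) (y1 y2 : R) :
  0 <= s -> 0 <= t -> s + t = 1 ->
  near s t theta c q1 p1 r1 y1 ->
  near s t theta c q2 p2 r2 y2 -> on_line s t q2 p2 r2 A2 B2 C2 ->
  Rabs (y1 - y2) <= 2 * rho -> 0 < c -> 1 <= M -> IZR q1 <= M * IZR q2 -> IZR q2 <= M * IZR q1 ->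
  4 * c * M <= 1 / 2 -> 2 * rho * (IZR q1 * IZR B2) < 1 / 2 ->
  (A2 * p1 + B2 * r1 + C2 * q1 = 0)%Z.
Proof.
  intros Hs Ht Hst Hn1 Hn2 Hl2 Hy Hc HM Hq12 Hq21 HcM Hrho.
  assert (H2 := line_value _ _ _ _ _ _ _ _ _ _ _ Hn2 Hl2).
  assert (Hx1 := near_x _ _ _ _ _ _ _ _ Hn1); assert (Hy1 := near_y _ _ _ _ _ _ _ _ Hn1).
  destruct Hn1 as [Hq1 _], Hn2 as [Hq2 _], Hl2 as [_ [HB2 [HA2 HB2']]].
  apply (IZR_le 1) in Hq1, Hq2, HB2.
  assert (Hs21 := Rpower_comparable (IZR q1) (IZR q2) M s ltac:(lra) ltac:(lra) HM Hq21 ltac:(lra)).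
  assert (Ht21 := Rpower_comparable (IZR q1) (IZR q2) M t ltac:(lra) ltac:(lra) HM Hq21 ltac:(lra)).
  assert (0 < Rpower (IZR q1) s) by apply exp_pos.
  assert (0 < Rpower (IZR q1) t) by apply exp_pos.
  apply Rabs_IZR_lt_1; rewrite !plus_IZR, !mult_IZR.
  replace (IZR A2 * IZR p1 + IZR B2 * IZR r1 + IZR C2 * IZR q1) with
    (IZR q1 * (IZR A2 * theta + IZR B2 * y2 + IZR C2)
     + - (IZR A2 * (IZR q1 * theta - IZR p1)) + - (IZR B2 * (IZR q1 * y1 - IZR r1))
     + IZR q1 * IZR B2 * (y1 - y2)) by ring.
  assert (T1 : Rabs (IZR q1 * (IZR A2 * theta + IZR B2 * y2 + IZR C2)) <= 2 * c * M).
  { eapply Rle_trans; [apply (Rabs_mult_le _ _ (M * IZR q2) (2 * c / IZR q2)); [rewrite Rabs_right; lra | exact H2] |].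
    right; field; lra. }
  assert (T2 : Rabs (- (IZR A2 * (IZR q1 * theta - IZR p1))) <= c * M).
  { rewrite Rabs_Ropp; eapply Rle_trans;
      [apply (Rabs_mult_le _ _ (M * Rpower (IZR q1) s) (c / Rpower (IZR q1) s)); [lra | exact Hx1] |].
    right; field; lra. }
  assert (T3 : Rabs (- (IZR B2 * (IZR q1 * y1 - IZR r1))) <= c * M).
  { rewrite Rabs_Ropp; eapply Rle_trans;
      [apply (Rabs_mult_le _ _ (M * Rpower (IZR q1) t) (c / Rpower (IZR q1) t)); [rewrite Rabs_right; lra | exact Hy1] |].
    right; field; lra. }
  assert (T4 : Rabs (IZR q1 * IZR B2 * (y1 - y2)) <= IZR q1 * IZR B2 * (2 * rho)).
  { apply Rabs_mult_le; [rewrite Rabs_right; nra | exact Hy]. }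
  eapply Rle_lt_trans; [apply (Rabs_triang_le _ _ _ _ (Rabs_triang_le _ _ _ _
    (Rabs_triang_le _ _ _ _ T1 T2) T3) T4) |]. lra.
Qed.

(** The bound [c / q^(1+t)] from nearness is weakened, by [B <= q^t], to the shape of the one in
    [same_line_close]. *)
Lemma point_close (s t theta c : R) (q p r B : Z) (y : R) :
  near s t theta c q p r y -> (1 <= B)%Z -> IZR B <= Rpower (IZR q) t -> 0 < c ->
  Rabs (y - IZR r / IZR q) <= 2 * c / (IZR q * IZR B).
Proof.
  intros Hn HB HB' Hc; assert (Hy := near_y _ _ _ _ _ _ _ _ Hn).
  destruct Hn as [Hq _]; apply (IZR_le 1) in Hq, HB.
  replace (y - IZR r / IZR q) with ((IZR q * y - IZR r) * / IZR q) by (field; lra).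
  rewrite Rabs_mult, (Rabs_right (/ IZR q)) by (left; apply Rinv_0_lt_compat; lra).
  replace (2 * c / (IZR q * IZR B)) with (2 * c / IZR B * / IZR q) by (field; lra).
  apply Rmult_le_compat_r; [left; apply Rinv_0_lt_compat; lra |].
  eapply Rle_trans; [exact Hy |].
  unfold Rdiv; apply Rmult_le_compat; try lra.
  - left; apply Rinv_0_lt_compat; lra.
  - apply Rinv_le_contravar; lra.
Qed.

Lemma two_points_on_line (A B C p1 r1 q1 p2 r2 q2 : Z) :
  (A * p1 + B * r1 + C * q1 = 0 -> A * p2 + B * r2 + C * q2 = 0 ->
   A * (p1 * q2 - p2 * q1) = - B * (r1 * q2 - r2 * q1))%Z.
Proof.
  intros E1 E2; apply (f_equal (fun x => x * q2)%Z) in E1.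
  apply (f_equal (fun x => x * q1)%Z) in E2; lia.
Qed.

(* Two such points lie on each other's lines, so either the points or the lines agree. *)
Lemma pair_small_gap (s t theta c rho M : R) (q1 p1 r1 A1 B1 C1 q2 p2 r2 A2 B2 C2 : Z) (y1 y2 : R) :
  0 <= s -> 0 <= t -> s + t = 1 ->
  near s t theta c q1 p1 r1 y1 -> on_line s t q1 p1 r1 A1 B1 C1 ->
  near s t theta c q2 p2 r2 y2 -> on_line s t q2 p2 r2 A2 B2 C2 ->
  Rabs (y1 - y2) <= 2 * rho -> 0 < c -> 1 <= M -> IZR q1 <= M * IZR q2 -> IZR q2 <= M * IZR q1 ->
  4 * c * M <= 1 / 2 ->
  2 * rho * (IZR q1 * IZR B2) < 1 / 2 -> 2 * rho * (IZR q2 * IZR B1) < 1 / 2 ->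
  Rabs (y1 - y2) <= 2 * c / (IZR q1 * IZR B1) + 2 * c / (IZR q2 * IZR B2).
Proof.
  intros Hs Ht Hst Hn1 Hl1 Hn2 Hl2 Hy Hc HM Hq12 Hq21 HcM Hr12 Hr21.
  assert (I12 := incident _ _ _ _ _ _ _ _ _ _ _ _ _ _ _ _ _ Hs Ht Hst Hn1 Hn2 Hl2 Hy Hc HM Hq12 Hq21 HcM Hr12).
  rewrite Rabs_minus_sym in Hy.
  assert (I21 := incident _ _ _ _ _ _ _ _ _ _ _ _ _ _ _ _ _ Hs Ht Hst Hn2 Hn1 Hl1 Hy Hc HM Hq21 Hq12 HcM Hr21).
  assert (H1 := Hl1); destruct H1 as [E1 [HB1 [_ HB1']]].
  assert (H2 := Hl2); destruct H2 as [E2 [HB2 [_ HB2']]].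
  assert (Hq1 := proj1 Hn1); assert (Hq2 := proj1 Hn2).
  assert (D1 := two_points_on_line _ _ _ _ _ _ _ _ _ E1 I21).
  assert (D2 := two_points_on_line _ _ _ _ _ _ _ _ _ I12 E2).
  destruct (Z.eq_dec (p1 * q2) (p2 * q1)) as [Ep | Ep].
  - assert (Er : (r1 * q2 = r2 * q1)%Z).
    { apply (Z.mul_reg_l _ _ B1); [lia |]. rewrite Ep, Z.sub_diag in D1; lia. }
    assert (H1 := point_close _ _ _ _ _ _ _ _ _ Hn1 HB1 HB1' Hc).
    assert (H2 := point_close _ _ _ _ _ _ _ _ _ Hn2 HB2 HB2' Hc).
    replace (y1 - y2) with ((y1 - IZR r1 / IZR q1) + - (y2 - IZR r2 / IZR q2)).
    + apply Rabs_triang_le; rewrite ?Rabs_Ropp; assumption.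
    + apply (IZR_le 1) in Hq1, Hq2; apply Zeq_IZR in Er; rewrite !mult_IZR in Er.
      assert (IZR r1 / IZR q1 = IZR r2 / IZR q2); [| lra].
      apply (Rmult_eq_reg_r (IZR q1 * IZR q2)); [| nra].
      field_simplify; lra.
  - assert (EA : (A1 * B2 = A2 * B1)%Z).
    { apply (Z.mul_reg_r _ _ (p1 * q2 - p2 * q1)); [lia |].
      apply (f_equal (Z.mul B2)) in D1; apply (f_equal (Z.mul B1)) in D2; lia. }
    apply (same_line_close _ _ _ _ _ _ _ _ _ _ _ _ _ _ _ _ _ _ Hn1 Hl1 Hn2 Hl2 EA).
    apply (Z.mul_reg_r _ _ q1); [lia |].
    apply (f_equal (Z.mul p1)) in EA.
    apply (f_equal (Z.mul B2)) in E1; apply (f_equal (Z.mul B1)) in I12; lia.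
Qed.

(** The meeting point of two lines comes with a denominator of either sign. *)
Lemma near_of_abs (s t theta c : R) (q p r : Z) (y : R) : (q <> 0)%Z ->
  Rpower (Rabs (IZR q)) s * Rabs (IZR q * theta - IZR p) < c ->
  Rpower (Rabs (IZR q)) t * Rabs (IZR q * y - IZR r) < c ->
  exists p' r' : Z, near s t theta c (Z.abs q) p' r' y.
Proof.
  intros Hq H1 H2; destruct (Z_le_gt_dec 0 q) as [Hs | Hs].
  - exists p, r; rewrite <- abs_IZR, Z.abs_eq in * by lia. repeat split; auto; lia.
  - exists (- p)%Z, (- r)%Z; rewrite <- abs_IZR, Z.abs_neq in * by lia.
    rewrite !opp_IZR in *; repeat split; try lia.
    + rewrite !opp_IZR; rewrite <- Rabs_Ropp in H1.
      replace (- IZR q * theta - - IZR p) with (- (IZR q * theta - IZR p)) by ring; exact H1.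
    + rewrite !opp_IZR; rewrite <- Rabs_Ropp in H2.
      replace (- IZR q * y - - IZR r) with (- (IZR q * y - IZR r)) by ring; exact H2.
Qed.

(* [ln K], with [K = q^t / B]. *)
Definition gap (t : R) (q B : Z) : R := t * ln (IZR q) - ln (IZR B).

(** The cross product [(q0, p0, r0)] of the lines represents their meeting point. Cramer's rule
    writes [q0 theta - p0] and [q0 y2 - r0] as combinations of the two linear forms at
    [(theta, y2)], which are small. As [|q0| <= 2 M q2 / K], the factor [K^(-t)] in [|q0|^t] beats
    the [K^(t/2)] allowed in [rho]. So the meeting point is near [y2] with the same [c], a descent
    in the denominator. *)
Lemma pair_large_gap (s t theta c rho M delta : R)
    (q1 p1 r1 A1 B1 C1 q2 p2 r2 A2 B2 C2 : Z) (y1 y2 : R) :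
  0 <= s -> 0 < t -> s + t = 1 ->
  near s t theta c q1 p1 r1 y1 -> on_line s t q1 p1 r1 A1 B1 C1 ->
  near s t theta c q2 p2 r2 y2 -> on_line s t q2 p2 r2 A2 B2 C2 ->
  Rabs (y1 - y2) <= 2 * rho -> 0 < c -> 1 <= M ->
  IZR q1 <= M * IZR q2 -> IZR q2 <= M * IZR q1 -> IZR B1 <= M * IZR B2 ->
  rho <= delta * exp (- ((1 + t) * ln (IZR q2) - (1 + t / 2) * gap t q2 B2)) -> 0 < delta ->
  8 * M² * delta < c -> 16 * c * M <= 1 -> 16 * M² <= exp (t * gap t q2 B2) ->
  (A1 * B2 = A2 * B1 /\ B1 * C2 = B2 * C1)%Z \/
  exists q0 p0 r0 : Z, (q0 < q2)%Z /\ near s t theta c q0 p0 r0 y2.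
Proof.
  unfold Rsqr.
  intros Hs Ht Hst Hn1 Hl1 Hn2 Hl2 Hy Hc HM Hq12 Hq21 HB12 Hrho Hdelta Hdc HcM HG.
  assert (F1 := line_value _ _ _ _ _ _ _ _ _ _ _ Hn1 Hl1).
  assert (F2 := line_value _ _ _ _ _ _ _ _ _ _ _ Hn2 Hl2).
  destruct Hn1 as [Hq1 _], Hn2 as [Hq2 _].
  destruct Hl1 as [_ [HB1 [HA1 _]]], Hl2 as [_ [HB2 [HA2 HB2']]].
  apply (IZR_le 1) in Hq1, Hq2, HB1, HB2.
  assert (Hs12 := Rpower_comparable (IZR q2) (IZR q1) M s ltac:(lra) ltac:(lra) HM Hq12 ltac:(lra)).
  set (X := ln (IZR q2)) in *; set (G := gap t q2 B2) in *.
  assert (EX : IZR q2 = exp X) by (unfold X; rewrite exp_ln; lra).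
  assert (EB : IZR B2 = exp (t * X - G)).
  { replace (t * X - G) with (ln (IZR B2)) by (unfold G, gap, X; ring). rewrite exp_ln; lra. }
  assert (EP : forall a, Rpower (IZR q2) a = exp (a * X)) by reflexivity.
  rewrite EP in HA2, HB2', Hs12.
  assert (HG0 : 0 <= G).
  { destruct (Rle_or_lt 0 G) as [H | H]; auto.
    rewrite EB in HB2'; assert (exp (t * X) < exp (t * X - G)) by (apply exp_increasing; lra); lra. }
  assert (HGX : G <= t * X).
  { destruct (Rle_or_lt G (t * X)) as [H | H]; auto.
    assert (H1 : exp (t * X - G) < exp 0) by (apply exp_increasing; lra).
    rewrite exp_0 in H1; lra. }
  assert (EtG : exp (- (t * G)) * (16 * (M * M)) <= 1).
  { rewrite exp_Ropp; apply (Rmult_le_reg_l (exp (t * G))); [apply exp_pos |].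
    assert (0 < exp (t * G)) by apply exp_pos. field_simplify; lra. }
  assert (EG : exp (- G) <= exp (- (t * G))) by (apply exp_le; nra).
  assert (F1' : Rabs (IZR A1 * theta + IZR B1 * y2 + IZR C1)
                <= 2 * c * M * exp (- X) + 2 * M * exp (t * X - G) * rho).
  { replace (IZR A1 * theta + IZR B1 * y2 + IZR C1) with
      ((IZR A1 * theta + IZR B1 * y1 + IZR C1) + IZR B1 * - (y1 - y2)) by ring.
    apply Rabs_triang_le.
    - eapply Rle_trans; [exact F1 |]. rewrite exp_Ropp, <- EX.
      replace (2 * c * M * / IZR q2) with (2 * c * (M * / IZR q2)) by ring.
      apply Rmult_le_compat_l; [lra |].
      apply (Rmult_le_reg_l (IZR q1 * IZR q2)); [nra |]. field_simplify; lra.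
    - eapply Rle_trans; [apply (Rabs_mult_le _ _ (M * IZR B2) (2 * rho)) |].
      + rewrite Rabs_right; lra.
      + rewrite Rabs_Ropp; exact Hy.
      + rewrite EB; lra. }
  assert (F2' : Rabs (IZR A2 * theta + IZR B2 * y2 + IZR C2) <= 2 * c * exp (- X)).
  { rewrite exp_Ropp, <- EX; exact F2. }
  clear F1 F2.
  set (q0 := (A1 * B2 - A2 * B1)%Z).
  set (p0 := (B1 * C2 - B2 * C1)%Z).
  set (r0 := (C1 * A2 - C2 * A1)%Z).
  assert (Hq0 : Rabs (IZR q0) <= 2 * M * exp (X - G)).
  { unfold q0, Z.sub; rewrite plus_IZR, opp_IZR, !mult_IZR.
    assert (HB1' : Rabs (- IZR B1) <= M * IZR B2) by (rewrite Rabs_Ropp, Rabs_right; lra).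
    assert (HB2'' : Rabs (IZR B2) <= IZR B2) by (rewrite Rabs_right; lra).
    rewrite Ropp_mult_distr_r.
    eapply Rle_trans; [apply (Rabs_triang_le _ _ _ _
      (Rabs_mult_le _ _ _ _ (Rle_trans _ _ _ HA1 Hs12) HB2'') (Rabs_mult_le _ _ _ _ HA2 HB1')) |].
    rewrite EB. replace (exp (X - G)) with (exp (s * X) * exp (t * X - G)); [lra |].
    rewrite <- exp_plus; f_equal; replace s with (1 - t) by lra; field. }
  assert (Hrho' : forall b,
    2 * M * exp b * rho <= 2 * M * delta * exp (b - ((1 + t) * X - (1 + t / 2) * G))).
  { intros b. unfold Rminus at 1; rewrite exp_plus.
    assert (0 < exp b) by apply exp_pos.
    replace (2 * M * delta * (exp b * exp (- ((1 + t) * X - (1 + t / 2) * G)))) with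
      (2 * M * exp b * (delta * exp (- ((1 + t) * X - (1 + t / 2) * G)))) by ring.
    apply Rmult_le_compat_l; [nra | exact Hrho]. }
  assert (Hu : Rabs (IZR q0 * theta - IZR p0) <=
      exp (- (s * X)) * (4 * c * M * exp (- G) + 2 * M * delta)).
  { replace (IZR q0 * theta - IZR p0) with
      (IZR B2 * (IZR A1 * theta + IZR B1 * y2 + IZR C1)
       + - IZR B1 * (IZR A2 * theta + IZR B2 * y2 + IZR C2))
      by (unfold q0, p0; rewrite !minus_IZR, !mult_IZR; ring).
    assert (HB1' : Rabs (- IZR B1) <= M * IZR B2) by (rewrite Rabs_Ropp, Rabs_right; lra).
    assert (HB2'' : Rabs (IZR B2) <= IZR B2) by (rewrite Rabs_right; lra).
    eapply Rle_trans; [apply (Rabs_triang_le _ _ _ _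
      (Rabs_mult_le _ _ _ _ HB2'' F1') (Rabs_mult_le _ _ _ _ HB1' F2')) |].
    rewrite EB.
    assert (H := Hrho' (t * X - G + (t * X - G))).
    assert (E1 : exp (t * X - G) * exp (- X) = exp (- (s * X)) * exp (- G))
      by (rewrite <- !exp_plus; f_equal; replace s with (1 - t) by lra; ring).
    assert (E2 : exp (t * X - G + (t * X - G) - ((1 + t) * X - (1 + t / 2) * G))
      <= exp (- (s * X))) by (apply exp_le; replace s with (1 - t) by lra; nra).
    rewrite exp_plus in H.
    assert (2 * M * delta * exp (t * X - G + (t * X - G) - ((1 + t) * X - (1 + t / 2) * G))
      <= 2 * M * delta * exp (- (s * X))) by (apply Rmult_le_compat_l; nra).
    replace (exp (t * X - G) * (2 * c * M * exp (- X) + 2 * M * exp (t * X - G) * rho)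
       + M * exp (t * X - G) * (2 * c * exp (- X))) with
      (4 * c * M * (exp (t * X - G) * exp (- X)) + 2 * M * (exp (t * X - G) * exp (t * X - G)) * rho)
      by ring.
    rewrite E1; lra. }
  assert (Hv : Rabs (IZR q0 * y2 - IZR r0) <=
      exp (- (t * X)) * (4 * c * M + 2 * M * delta * exp (t * G / 2))).
  { replace (IZR q0 * y2 - IZR r0) with
      (IZR A1 * (IZR A2 * theta + IZR B2 * y2 + IZR C2)
       + - IZR A2 * (IZR A1 * theta + IZR B1 * y2 + IZR C1))
      by (unfold q0, r0; rewrite !minus_IZR, !mult_IZR; ring).
    assert (HA2' : Rabs (- IZR A2) <= exp (s * X)) by (rewrite Rabs_Ropp; exact HA2).
    eapply Rle_trans; [apply (Rabs_triang_le _ _ _ _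
      (Rabs_mult_le _ _ _ _ (Rle_trans _ _ _ HA1 Hs12) F2') (Rabs_mult_le _ _ _ _ HA2' F1')) |].
    assert (H := Hrho' (s * X + (t * X - G))).
    assert (E1 : exp (s * X) * exp (- X) = exp (- (t * X)))
      by (rewrite <- !exp_plus; f_equal; replace s with (1 - t) by lra; ring).
    assert (E2 : exp (s * X + (t * X - G) - ((1 + t) * X - (1 + t / 2) * G))
      = exp (- (t * X)) * exp (t * G / 2)) by (rewrite <- exp_plus; f_equal; replace s with (1 - t) by lra; field).
    rewrite E2, exp_plus in H.
    replace (M * exp (s * X) * (2 * c * exp (- X))
       + exp (s * X) * (2 * c * M * exp (- X) + 2 * M * exp (t * X - G) * rho)) with
      (4 * c * M * (exp (s * X) * exp (- X)) + 2 * M * (exp (s * X) * exp (t * X - G)) * rho) by ring.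
    rewrite E1; lra. }
  assert (HMM : M <= M * M) by nra.
  assert (HcG : 4 * c * M * exp (- G) <= c / 4).
  { assert (0 < exp (- G)) by apply exp_pos.
    assert (16 * M * exp (- G) <= 1) by nra. nra. }
  assert (HMd : 2 * M * delta < c / 4) by nra.
  assert (HX0 : 0 <= X) by nra.
  assert (Hq0lt : Rabs (IZR q0) < IZR q2).
  { rewrite EX; eapply Rle_lt_trans; [exact Hq0 |].
    unfold Rminus; rewrite exp_plus.
    assert (0 < exp X) by apply exp_pos. assert (0 < exp (- G)) by apply exp_pos.
    assert (2 * M * exp (- G) < 1) by nra. nra. }
  destruct (Z.eq_dec q0 0) as [E0 | E0].
  (* For parallel lines the bound on [q0 theta - p0] reads [|p0| < 1]; so [p0 = 0] and the lines
     agree. *)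
  - left; split; [unfold q0 in E0; lia |].
    assert (Hp0 : p0 = 0%Z); [| unfold p0 in Hp0; lia].
    apply Rabs_IZR_lt_1. rewrite E0, Rmult_0_l, Rminus_0_l, Rabs_Ropp in Hu.
    assert (exp (- (s * X)) <= 1) by (rewrite <- exp_0; apply exp_le; nra).
    assert (0 < exp (- (s * X))) by apply exp_pos.
    assert (c < 1) by nra. nra.
  - right; assert (H0 : 0 < Rabs (IZR q0)) by (apply Rabs_pos_lt, (eq_IZR_contrapositive q0 0), E0).
    destruct (near_of_abs s t theta c q0 p0 r0 y2 E0) as [p' [r' Hn]].
    + assert (HR : Rpower (Rabs (IZR q0)) s <= exp (s * X)).
      { rewrite <- EP; apply Rle_Rpower_l; lra. }
      eapply Rle_lt_trans; [apply Rmult_le_compat;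
        [left; apply exp_pos | apply Rabs_pos | exact HR | exact Hu] |].
      rewrite <- Rmult_assoc, <- exp_plus, Rplus_opp_r, exp_0; lra.
    + assert (HR : Rpower (Rabs (IZR q0)) t <= 2 * M * exp (t * X - t * G)).
      { eapply Rle_trans; [apply (Rle_Rpower_l _ (2 * M * exp (X - G))); lra |].
        assert (0 < exp (X - G)) by apply exp_pos.
        rewrite <- Rpower_mult_distr by lra.
        replace (Rpower (exp (X - G)) t) with (exp (t * X - t * G))
          by (unfold Rpower; rewrite ln_exp; f_equal; ring).
        apply Rmult_le_compat_r; [left; apply exp_pos |].
        rewrite <- (Rpower_1 (2 * M)) at 2 by lra. apply Rle_Rpower; lra. }
      eapply Rle_lt_trans; [apply Rmult_le_compat;
        [left; apply exp_pos | apply Rabs_pos | exact HR | exact Hv] |].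
      replace (2 * M * exp (t * X - t * G) *
        (exp (- (t * X)) * (4 * c * M + 2 * M * delta * exp (t * G / 2)))) with
        (exp (t * X - t * G) * exp (- (t * X)) * (8 * c * (M * M) + 4 * (M * M) * delta * exp (t * G / 2)))
        by ring.
      rewrite <- exp_plus; replace (t * X - t * G + - (t * X)) with (- (t * G)) by ring.
      (* Of the two terms, the first is at most [c / 2] by [16 M^2 <= K^t], the second is below
         [c / 2] by [8 M^2 delta < c]. *)
      assert (E3 : exp (- (t * G)) * exp (t * G / 2) <= 1).
      { rewrite <- exp_plus, <- exp_0; apply exp_le; nra. }
      assert (0 < (M * M) * delta) by nra.
      nra.
    + exists (Z.abs q0), p', r'; split; [| exact Hn].
      apply lt_IZR; rewrite abs_IZR; exact Hq0lt.
Qed.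

(** * Stages and classes *)

(* [ln (H / K^(t/2))], with [H = q B]. *)
Definition scale (t : R) (q B : Z) : R := ln (IZR q) + ln (IZR B) - t / 2 * gap t q B.

Lemma ln_ge_0 (x : R) : 1 <= x -> 0 <= ln x.
Proof. intros H; rewrite <- ln_1; destruct H as [H | <-]; [left; apply ln_increasing |]; lra. Qed.

Lemma exp_ge_1 (a : R) : 0 <= a -> 1 <= exp a.
Proof. intros H; rewrite <- exp_0; now apply exp_le. Qed.

Lemma le_exp_mul_of_ln (x y a : R) : 0 < x -> 0 < y -> ln x <= a + ln y -> x <= exp a * y.
Proof.
  intros Hx Hy H; rewrite <- (exp_ln x), <- (exp_ln y), <- exp_plus by assumption.
  now apply exp_le.
Qed.

(** Scale and gap determine [q] and [B], by [(1 + t) ln q = scale + (1 + t/2) gap] and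
    [ln B = t ln q - gap]. With [g = w / t] the gaps differ by at most [2g], so
    [ln q1 - ln q2 <= l + 3g] and the difference of the [ln B] is at most [l + 5g]. *)
Lemma comparable (t l w : R) (q1 B1 q2 B2 : Z) :
  0 < t <= 1 -> 0 <= l -> (1 <= q1)%Z -> (1 <= B1)%Z -> (1 <= q2)%Z -> (1 <= B2)%Z ->
  scale t q1 B1 <= l + scale t q2 B2 ->
  Rabs (t / 2 * gap t q1 B1 - t / 2 * gap t q2 B2) <= w ->
  IZR q1 <= exp (l + 5 * w / t) * IZR q2 /\ IZR B1 <= exp (l + 5 * w / t) * IZR B2.
Proof.
  intros Ht Hl Hq1 HB1 Hq2 HB2 Hsc Hg.
  apply (IZR_le 1) in Hq1, HB1, Hq2, HB2.
  unfold scale in Hsc.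
  assert (E : forall q B, ln (IZR B) = t * ln (IZR q) - gap t q B) by (intros; unfold gap; ring).
  rewrite (E q1 B1), (E q2 B2) in Hsc.
  set (g := w / t); assert (Hw : w = t * g) by (unfold g; field; lra).
  replace (5 * w / t) with (5 * g) by (unfold g; field; lra).
  assert (Hg0 : 0 <= t * g) by (rewrite <- Hw; eapply Rle_trans; [apply Rabs_pos | exact Hg]).
  assert (Hg1 : 0 <= g) by nra.
  assert (Hd : Rabs (gap t q1 B1 - gap t q2 B2) <= 2 * g).
  { apply (Rmult_le_reg_l (t / 2)); [lra |].
    rewrite <- (Rabs_right (t / 2)) at 1 by lra. rewrite <- Rabs_mult, Rmult_minus_distr_l. lra. }
  assert (Hd1 := Rle_trans _ _ _ (Rle_abs _) Hd).
  rewrite Rabs_minus_sym in Hd; assert (Hd2 := Rle_trans _ _ _ (Rle_abs _) Hd).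
  assert (HX : ln (IZR q1) - ln (IZR q2) <= l + 3 * g).
  { assert ((1 + t) * (ln (IZR q1) - ln (IZR q2)) <= l + (1 + t / 2) * (2 * g)).
    { assert (H := Rmult_le_compat_l (1 + t / 2) _ _ ltac:(lra) Hd1). lra. }
    assert (t * g <= g) by nra. nra. }
  split; apply le_exp_mul_of_ln; try lra.
  rewrite (E q1 B1), (E q2 B2).
  assert (t * (ln (IZR q1) - ln (IZR q2)) <= l + 3 * g) by nra. lra.
Qed.

Lemma floor_nat (v : R) : 0 <= v -> exists n : nat, INR n <= v < INR n + 1.
Proof.
  intros Hv; destruct (base_Int_part v) as [H1 H2].
  assert (0 <= Int_part v)%Z by (assert (-1 < Int_part v)%Z; [apply lt_IZR |]; lia || lra).
  exists (Z.to_nat (Int_part v)); rewrite INR_IZR_INZ, Z2Nat.id by assumption. lra.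
Qed.

(** Here [rho] is the radius of Bob's ball. The first window, of logarithmic length [l], fixes the
    stage; the second confines [ln (K^(t/2))]. *)
Definition in_class (s t theta c l delta lo hi rho y : R) : Prop :=
  exists q p r A B C : Z,
    near s t theta c q p r y /\ on_line s t q p r A B C /\
    delta * exp (- l) <= rho * exp (scale t q B) <= delta /\
    lo <= t / 2 * gap t q B <= hi.

(** The first bound restates [B <= q^t]. The second will yield [k <= n]: a point of range [k] is not
    handled before stage [k]. *)
Lemma gap_bounds (s t : R) (q p r A B C : Z) :
  0 < t <= 1 -> (1 <= q)%Z -> on_line s t q p r A B C ->
  0 <= gap t q B /\ t / 2 * gap t q B <= scale t q B.
Proof.
  intros Ht Hq [_ [HB [_ HB']]]; apply (IZR_le 1) in Hq, HB.
  assert (HX := ln_ge_0 _ Hq); assert (HY := ln_ge_0 _ HB).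
  assert (HG : ln (IZR B) <= t * ln (IZR q)).
  { rewrite <- (ln_exp (t * ln (IZR q))).
    destruct HB' as [H | H]; [left; apply ln_increasing; auto; lra | right; now rewrite H]. }
  unfold scale, gap; split; [lra | nra].
Qed.

(** Since [scale] is [ln (q B) - ln (K^(t/2))], the dangerous interval is smaller than Bob's ball by
    a factor of order [K^(-t/2) <= exp (- lo)]. This is what lets obstacles of range [k] wait for
    [k] further moves. *)
Lemma class_radius (t c l delta lo rho : R) (q B : Z) :
  0 < c -> 0 < delta -> (1 <= q)%Z -> (1 <= B)%Z ->
  delta * exp (- l) <= rho * exp (scale t q B) -> lo <= t / 2 * gap t q B ->
  2 * c / (IZR q * IZR B) <= 2 * c * (rho * exp l / delta) * exp (- lo).
Proof.
  intros Hc Hd Hq HB H Hlo; apply (IZR_le 1) in Hq, HB.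
  assert (E : / (IZR q * IZR B) = exp (- scale t q B) * exp (- (t / 2 * gap t q B))).
  { rewrite <- exp_plus.
    replace (- scale t q B + - (t / 2 * gap t q B)) with (- (ln (IZR q) + ln (IZR B)))
      by (unfold scale; ring).
    rewrite exp_Ropp, exp_plus, !exp_ln by lra; reflexivity. }
  unfold Rdiv at 1; rewrite E, !Rmult_assoc.
  apply Rmult_le_compat_l; [lra |]; apply Rmult_le_compat_l; [lra |].
  apply Rmult_le_compat; try (left; apply exp_pos); [| apply exp_le; lra].
  rewrite exp_Ropp in H |- *.
  assert (0 < exp (scale t q B)) by apply exp_pos. assert (0 < exp l) by apply exp_pos.
  apply (Rmult_le_reg_r (delta * exp (scale t q B) * / exp l));
    [apply Rmult_lt_0_compat; [nra | apply Rinv_0_lt_compat; lra] |].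
  field_simplify; [| lra | lra]. unfold Rdiv; lra.
Qed.

Lemma scale_window (rho delta l S1 S2 : R) : 0 < rho ->
  delta * exp (- l) <= rho * exp S2 -> rho * exp S1 <= delta -> S1 <= l + S2.
Proof.
  intros Hrho H1 H2; apply Rnot_lt_le; intros H.
  assert (H3 : exp (l + S2) < exp S1) by now apply exp_increasing.
  rewrite exp_plus in H3; rewrite exp_Ropp in H1; assert (0 < exp l) by apply exp_pos.
  apply (Rmult_le_compat_l (exp l)) in H1; [| lra].
  replace (exp l * (delta * / exp l)) with delta in H1 by (field; lra). nra.
Qed.

(** When [K^(t/2) <= exp w], the products [rho q B] are at most [delta * exp w], so the incidence
    conditions of [pair_small_gap] hold once [delta] is small in terms of [w]. *)
Lemma class_close_small (s t theta c l delta w rho eta y1 y2 : R) :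
  0 <= s -> 0 < t -> s + t = 1 -> 0 < c -> 0 <= l -> 0 < delta -> 0 <= w ->
  8 * c * exp (l + 5 * w / t) <= 1 -> 8 * delta * exp (l + 5 * w / t) * exp w <= 1 ->
  4 * c * exp l <= delta * eta -> 0 < rho ->
  Rabs (y1 - y2) <= 2 * rho ->
  in_class s t theta c l delta 0 w rho y1 -> in_class s t theta c l delta 0 w rho y2 ->
  Rabs (y1 - y2) <= rho * eta.
Proof.
  intros Hs Ht Hst Hc Hl Hd Hw HcM HdM Heta Hrho Hy
    [q1 [p1 [r1 [A1 [B1 [C1 [Hn1 [Hl1 [[Ha1 Hb1] [Hc1 Hd1]]]]]]]]]]
    [q2 [p2 [r2 [A2 [B2 [C2 [Hn2 [Hl2 [[Ha2 Hb2] [Hc2 Hd2]]]]]]]]]].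
  assert (Hq1 := proj1 Hn1); assert (Hq2 := proj1 Hn2).
  assert (HB1 := proj1 (proj2 Hl1)); assert (HB2 := proj1 (proj2 Hl2)).
  assert (Hw12 : Rabs (t / 2 * gap t q1 B1 - t / 2 * gap t q2 B2) <= w) by (apply Rabs_le; lra).
  destruct (comparable t l w q1 B1 q2 B2 ltac:(lra) Hl Hq1 HB1 Hq2 HB2 (scale_window _ _ _ _ _ Hrho Ha2 Hb1) Hw12) as [Q12 _].
  rewrite Rabs_minus_sym in Hw12.
  destruct (comparable t l w q2 B2 q1 B1 ltac:(lra) Hl Hq2 HB2 Hq1 HB1 (scale_window _ _ _ _ _ Hrho Ha1 Hb2) Hw12) as [Q21 _].
  set (M := exp (l + 5 * w / t)) in *.
  assert (HM : 1 <= M).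
  { apply exp_ge_1; assert (0 <= 5 * w / t) by (apply Rle_mult_inv_pos; lra). lra. }
  assert (Hprod : forall q q' B, (1 <= q)%Z -> (1 <= B)%Z -> IZR q' <= M * IZR q ->
    rho * exp (scale t q B) <= delta -> t / 2 * gap t q B <= w ->
    2 * rho * (IZR q' * IZR B) < 1 / 2).
  { intros q q' B Hq HB Hqq Hsc' Hg; apply (IZR_le 1) in Hq, HB.
    assert (E : IZR q * IZR B = exp (scale t q B) * exp (t / 2 * gap t q B)).
    { rewrite <- exp_plus.
      replace (scale t q B + t / 2 * gap t q B) with (ln (IZR q) + ln (IZR B)) by (unfold scale; ring).
      rewrite exp_plus, !exp_ln by lra; reflexivity. }
    assert (H1 : rho * (IZR q * IZR B) <= delta * exp w).
    { rewrite E, <- Rmult_assoc; apply Rmult_le_compat; auto.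
      - assert (0 < exp (scale t q B)) by apply exp_pos; nra.
      - left; apply exp_pos.
      - now apply exp_le. }
    assert (H2 : rho * (IZR q' * IZR B) <= M * (rho * (IZR q * IZR B))).
    { replace (M * (rho * (IZR q * IZR B))) with (rho * ((M * IZR q) * IZR B)) by ring.
      apply Rmult_le_compat_l; [lra |]; apply Rmult_le_compat_r; lra. }
    assert (M * (rho * (IZR q * IZR B)) <= M * (delta * exp w)) by (apply Rmult_le_compat_l; lra).
    lra. }
  assert (Hclose := pair_small_gap _ _ _ _ _ _ _ _ _ _ _ _ _ _ _ _ _ _ _ _
    Hs (Rlt_le _ _ Ht) Hst Hn1 Hl1 Hn2 Hl2 Hy Hc HM Q12 Q21 ltac:(lra)
    (Hprod _ _ _ Hq2 HB2 Q12 Hb2 Hd2) (Hprod _ _ _ Hq1 HB1 Q21 Hb1 Hd1)).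
  assert (R1 := class_radius t c l delta 0 rho q1 B1 Hc Hd Hq1 HB1 Ha1 Hc1).
  assert (R2 := class_radius t c l delta 0 rho q2 B2 Hc Hd Hq2 HB2 Ha2 Hc2).
  rewrite Ropp_0, exp_0 in R1, R2.
  assert (4 * c * (rho * exp l / delta) <= rho * eta); [| lra].
  apply (Rmult_le_reg_l delta); [exact Hd |].
  replace (delta * (4 * c * (rho * exp l / delta))) with (rho * (4 * c * exp l)) by (field; lra).
  replace (delta * (rho * eta)) with (rho * (delta * eta)) by ring.
  apply Rmult_le_compat_l; lra.
Qed.

(** The second rational point is given explicitly, not hidden in [in_class], because the alternative
    outcome is a descent on its denominator. *)
Lemma class_close_large (s t theta c l delta a rho eta y1 y2 : R) (q2 p2 r2 A2 B2 C2 : Z) :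
  0 <= s -> 0 < t -> s + t = 1 -> 0 < c -> 0 <= l -> 0 < delta ->
  16 * c * exp (l + 5 * l / t) <= 1 -> 8 * (exp (l + 5 * l / t))² * delta < c ->
  16 * (exp (l + 5 * l / t))² <= exp (2 * a) ->
  4 * c * exp l * exp (- a) <= delta * eta -> 0 < rho ->
  Rabs (y1 - y2) <= 2 * rho ->
  in_class s t theta c l delta a (a + l) rho y1 ->
  near s t theta c q2 p2 r2 y2 -> on_line s t q2 p2 r2 A2 B2 C2 ->
  delta * exp (- l) <= rho * exp (scale t q2 B2) <= delta ->
  a <= t / 2 * gap t q2 B2 <= a + l ->
  Rabs (y1 - y2) <= rho * eta \/
  exists q0 p0 r0 : Z, (q0 < q2)%Z /\ near s t theta c q0 p0 r0 y2.
Proof.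
  intros Hs Ht Hst Hc Hl Hd HcM HdM Ha Heta Hrho Hy
    [q1 [p1 [r1 [A1 [B1 [C1 [Hn1 [Hl1 [[Ha1 Hb1] [Hc1 Hd1]]]]]]]]]]
    Hn2 Hl2 [Ha2 Hb2] [Hc2 Hd2].
  assert (Hq1 := proj1 Hn1); assert (Hq2 := proj1 Hn2).
  assert (HB1 := proj1 (proj2 Hl1)); assert (HB2 := proj1 (proj2 Hl2)).
  assert (Hw12 : Rabs (t / 2 * gap t q1 B1 - t / 2 * gap t q2 B2) <= l) by (apply Rabs_le; lra).
  destruct (comparable t l l q1 B1 q2 B2 ltac:(lra) Hl Hq1 HB1 Hq2 HB2
    (scale_window _ _ _ _ _ Hrho Ha2 Hb1) Hw12) as [Q12 BB12].
  rewrite Rabs_minus_sym in Hw12.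
  destruct (comparable t l l q2 B2 q1 B1 ltac:(lra) Hl Hq2 HB2 Hq1 HB1
    (scale_window _ _ _ _ _ Hrho Ha1 Hb2) Hw12) as [Q21 _].
  set (M := exp (l + 5 * l / t)) in *.
  assert (HM : 1 <= M).
  { apply exp_ge_1; assert (0 <= 5 * l / t) by (apply Rle_mult_inv_pos; lra). lra. }
  assert (Hrho' : rho <= delta * exp (- ((1 + t) * ln (IZR q2) - (1 + t / 2) * gap t q2 B2))).
  { replace ((1 + t) * ln (IZR q2) - (1 + t / 2) * gap t q2 B2) with (scale t q2 B2)
      by (unfold scale, gap; field).
    rewrite exp_Ropp; assert (0 < exp (scale t q2 B2)) by apply exp_pos.
    apply (Rmult_le_reg_r (exp (scale t q2 B2))); [lra |]. field_simplify; lra. }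
  assert (HG : 16 * M² <= exp (t * gap t q2 B2)).
  { eapply Rle_trans; [exact Ha | apply exp_le; lra]. }
  destruct (pair_large_gap _ _ _ _ _ _ _ _ _ _ _ _ _ _ _ _ _ _ _ _ _
    Hs Ht Hst Hn1 Hl1 Hn2 Hl2 Hy Hc HM Q12 Q21 BB12 Hrho' Hd HdM HcM HG) as [[EA EC] | H0];
    [left | right; exact H0].
  assert (Hclose := same_line_close _ _ _ _ _ _ _ _ _ _ _ _ _ _ _ _ _ _ Hn1 Hl1 Hn2 Hl2 EA EC).
  assert (R1 := class_radius t c l delta a rho q1 B1 Hc Hd Hq1 HB1 Ha1 Hc1).
  assert (R2 := class_radius t c l delta a rho q2 B2 Hc Hd Hq2 HB2 Ha2 Hc2).
  assert (4 * c * (rho * exp l / delta) * exp (- a) <= rho * eta); [| lra].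
  apply (Rmult_le_reg_l delta); [exact Hd |].
  replace (delta * (4 * c * (rho * exp l / delta) * exp (- a))) with
    (rho * (4 * c * exp l * exp (- a))) by (field; lra).
  replace (delta * (rho * eta)) with (rho * (delta * eta)) by ring.
  apply Rmult_le_compat_l; lra.
Qed.

(** * Obstacles covering every rational point *)

Lemma stage_exists (rho0 delta l S : R) : 0 < l -> 0 < delta <= rho0 -> 0 <= S ->
  exists n : nat,
    delta * exp (- l) <= rho0 * exp (- (INR n * l)) * exp S <= delta.
Proof.
  intros Hl [Hd Hdr] HS.
  assert (Hln : ln delta <= ln rho0).
  { destruct Hdr as [H | ->]; [left; now apply ln_increasing | lra]. }
  (* Each stage divides the radius by [exp l], so some stage falls into the window; [delta <= rho0]
     and [0 <= S] make the quotient nonnegative. *)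
  destruct (floor_nat ((S + ln rho0 - ln delta) / l)) as [n [H1 H2]].
  { apply Rle_mult_inv_pos; lra. }
  exists (Datatypes.S n); rewrite S_INR.
  apply (Rmult_le_compat_r l) in H1; [| lra]. apply (Rmult_lt_compat_r l) in H2; [| lra].
  unfold Rdiv in H1, H2; rewrite Rmult_assoc, Rinv_l, Rmult_1_r in H1, H2 by lra.
  assert (Er : rho0 = exp (ln rho0)) by (rewrite exp_ln; lra).
  assert (Ed : delta = exp (ln delta)) by (rewrite exp_ln; lra).
  rewrite Er at 1; rewrite Ed, <- !exp_plus; split; [| rewrite Er at 1; rewrite <- !exp_plus];
    apply exp_le; lra.
Qed.

(** The obstacle of class [k] is centred at any member of the class in Bob's ball. If [y] had a near
    point, then at its stage and class closeness would put [y] inside the obstacle, unless a near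
    point of smaller denominator existed, which induction excludes. *)
Lemma avoid_near (s t theta c0 rho0 l : R) :
  0 <= s -> 0 < t -> s + t = 1 -> 0 < c0 ->
  (s = 0 \/ forall q : nat, (1 <= q)%nat ->
         c0 <= Rpower (INR q) (1 / s) * dist_nint (INR q * theta)) ->
  0 < rho0 -> 0 < l ->
  exists (c : R) (z : ball -> nat -> R), 0 < c /\
    forall (b : nat -> ball) (y : R),
      (forall n, snd (b n) = rho0 * exp (- (INR n * l))) ->
      (forall n, in_ball y (b n)) ->
      (forall n k, (k <= n)%nat ->
         rho0 * exp (- (INR (n + k + delay) * l)) < Rabs (y - z (b n) k)) ->
      forall q p r : Z, ~ near s t theta c q p r y.
Proof.
  intros Hs Ht Hst Hc0 Hth Hrho0 Hl.
  (* The order of choice avoids circularity: the threshold [kappa] comes first, [delta1] serves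
     bounded [K], [c] is small against [delta1], and [delta2], for large [K], is proportional to
     [c]. *)
  set (M := exp (l + 5 * l / t)).
  (* The summands pay for the factors of [Hek]; there [36 = 4 * 9] comes from [4 * c] and
     [c = 9 * M² * delta2]. *)
  set (kappa := 36 + 2 * (l + 5 * l / t) + (INR delay + 1) * l).
  set (w := kappa + l).
  set (M0 := exp (l + 5 * w / t)).
  set (delta1 := Rmin rho0 (/ (8 * M0 * exp w))).
  set (c := Rmin (Rmin c0 rho0) (Rmin (delta1 * exp (- ((INR delay + 1) * l)) / 4)
    (Rmin (/ (8 * M0)) (/ (16 * M))))).
  (* The 9 makes [8 * M² * delta2 < c] strict. *)
  set (delta2 := c / (9 * M²)).
  assert (Hdelay : 0 <= INR delay) by apply pos_INR.
  assert (Hlt : 0 < 5 * l / t) by (apply Rdiv_lt_0_compat; lra).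
  assert (HM : 1 <= M) by (apply exp_ge_1; lra).
  assert (HM2 : 1 <= M²) by (unfold Rsqr; nra).
  assert (Hkappa : 0 <= kappa) by (unfold kappa; nra).
  assert (Hw : 0 <= w) by (unfold w; lra).
  assert (HM0 : 0 < M0) by apply exp_pos.
  assert (Hew : 0 < exp w) by apply exp_pos.
  assert (HMw : 0 < 8 * M0 * exp w) by nra.
  assert (Hd1 : 0 < delta1).
  { unfold delta1; apply Rmin_pos; [lra | apply Rinv_0_lt_compat; lra]. }
  assert (Hd1r : delta1 <= rho0) by apply Rmin_l.
  assert (Hd1w : 8 * delta1 * M0 * exp w <= 1).
  { assert (H : delta1 <= / (8 * M0 * exp w)) by apply Rmin_r.
    apply (Rmult_le_compat_l (8 * M0 * exp w)) in H; [| lra].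
    rewrite Rinv_r in H by lra; lra. }
  assert (Hc : 0 < c).
  { assert (0 < exp (- ((INR delay + 1) * l))) by apply exp_pos.
    unfold c; repeat apply Rmin_pos; try lra; try (apply Rinv_0_lt_compat; lra).
    apply Rdiv_lt_0_compat; [apply Rmult_lt_0_compat; lra | lra]. }
  assert (Hcc0 : c <= c0) by (unfold c; eapply Rle_trans; [apply Rmin_l | apply Rmin_l]).
  assert (Hcr : c <= rho0) by (unfold c; eapply Rle_trans; [apply Rmin_l | apply Rmin_r]).
  assert (Hcd : 4 * c * exp l <= delta1 * exp (- (INR delay * l))).
  { assert (H : c <= delta1 * exp (- ((INR delay + 1) * l)) / 4)
      by (unfold c; eapply Rle_trans; [apply Rmin_r | apply Rmin_l]).
    assert (0 < exp l) by apply exp_pos.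
    replace (exp (- (INR delay * l))) with (exp l * exp (- ((INR delay + 1) * l)))
      by (rewrite <- exp_plus; f_equal; ring).
    apply (Rmult_le_compat_l (exp l)) in H; lra. }
  assert (HcM0 : 8 * c * M0 <= 1).
  { assert (H : c <= / (8 * M0)).
    { unfold c; do 2 (eapply Rle_trans; [apply Rmin_r |]); apply Rmin_l. }
    apply (Rmult_le_compat_l (8 * M0)) in H; [| lra]. rewrite Rinv_r in H by lra; lra. }
  assert (HcM : 16 * c * M <= 1).
  { assert (H : c <= / (16 * M)).
    { unfold c; do 3 (eapply Rle_trans; [apply Rmin_r |]); apply Rle_refl. }
    apply (Rmult_le_compat_l (16 * M)) in H; [| lra]. rewrite Rinv_r in H by lra; lra. }
  assert (Ed2 : 9 * M² * delta2 = c) by (unfold delta2; field; lra).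
  assert (Hd2 : 0 < delta2) by (unfold delta2; apply Rdiv_lt_0_compat; lra).
  assert (Hd2c : delta2 <= c) by nra.
  assert (Hek : 36 * M² * exp ((INR delay + 1) * l) <= exp kappa).
  { unfold kappa; rewrite !exp_plus.
    apply Rmult_le_compat_r; [left; apply exp_pos |].
    replace (exp (2 * (l + 5 * l / t))) with M²
      by (unfold M, Rsqr; rewrite <- exp_plus; f_equal; ring).
    apply Rmult_le_compat_r; [lra |]. pose proof (exp_ineq1_le 36); lra. }
  assert (Hedl : 1 <= exp ((INR delay + 1) * l)) by (apply exp_ge_1, Rmult_le_pos; lra).
  (* Class 0 is the bounded range [K^(t/2) <= exp w]; as [w = kappa + l], class 1 starts where it
     ends. *)
  set (cls := fun (rho : R) (k : nat) (y : R) => match k with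
    | O => in_class s t theta c l delta1 0 w rho y
    | _ => in_class s t theta c l delta2 (kappa + INR k * l) (kappa + INR k * l + l) rho y
    end).
  (* If the class has no member in the ball, [epsilon] returns an arbitrary real, and avoiding it is
     harmless. *)
  exists c, (fun b k => epsilon (inhabits 0) (fun y => in_ball y b /\ cls (snd b) k y)).
  split; [exact Hc |]. intros b y Hb Hy Havoid.
  assert (Hstar : forall n k, (k <= n)%nat -> cls (snd (b n)) k y -> exists y1,
    Rabs (y1 - y) <= 2 * snd (b n) /\ cls (snd (b n)) k y1 /\
    rho0 * exp (- (INR (n + k + delay) * l)) < Rabs (y1 - y)).
  { intros n k Hk Hcls.
    destruct (epsilon_spec (inhabits 0) (fun y => in_ball y (b n) /\ cls (snd (b n)) k y)
      (ex_intro _ y (conj (Hy n) Hcls))) as [H1 H2].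
    eexists; split; [| split; [exact H2 |]].
    - specialize (Hy n); unfold in_ball in H1, Hy; rewrite Rabs_minus_sym in Hy.
      match goal with |- Rabs (?a - _) <= _ =>
        replace (a - y) with ((a - fst (b n)) + (fst (b n) - y)) by ring end.
      eapply Rle_trans; [apply (Rabs_triang_le _ _ _ _ H1 Hy) | lra].
    - rewrite Rabs_minus_sym; now apply Havoid. }
  assert (Hrad : forall n k, snd (b n) * exp (- (INR (k + delay) * l)) =
      rho0 * exp (- (INR (n + k + delay) * l))).
  { intros n k; rewrite Hb, Rmult_assoc, <- exp_plus; do 2 f_equal; rewrite !plus_INR; ring. }
  assert (Hrho : forall n, 0 < snd (b n)).
  { intros n; rewrite Hb; apply Rmult_lt_0_compat; [lra | apply exp_pos]. }
  (* Strong induction on [q] plays the role of a smallest denominator endangering [y]. *)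
  assert (Hmain : forall q, (0 <= q)%Z -> forall p r, ~ near s t theta c q p r y).
  2: { intros q p r Hn; apply (Hmain q) with p r; [destruct Hn; lia | exact Hn]. }
  apply (Z_lt_induction (fun q => forall p r, ~ near s t theta c q p r y)).
  intros q IH p r Hn; assert (Hq := proj1 Hn).
  destruct (line_exists _ _ _ _ _ _ _ _ _ Hs (Rlt_le _ _ Ht) Hst Hth Hcc0 Hn) as [A [B [C Hline]]].
  destruct (gap_bounds s t q p r A B C ltac:(lra) Hq Hline) as [HG HGS].
  assert (HS : 0 <= scale t q B) by nra.
  destruct (Rle_or_lt (t / 2 * gap t q B) w) as [Hgw | Hgw].
  - destruct (stage_exists rho0 delta1 l (scale t q B) Hl ltac:(lra) HS) as [n Hstage].
    rewrite <- Hb in Hstage.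
    assert (Hcls : cls (snd (b n)) 0%nat y).
    { simpl; exists q, p, r, A, B, C; repeat split; try apply Hn; try apply Hline; try apply Hstage; nra. }
    destruct (Hstar n 0%nat ltac:(lia) Hcls) as [y1 [H1 [H2 H3]]].
    assert (H4 := class_close_small s t theta c l delta1 w (snd (b n)) (exp (- (INR delay * l)))
      y1 y Hs Ht Hst Hc (Rlt_le _ _ Hl) Hd1 Hw HcM0 Hd1w Hcd (Hrho n) H1 H2 Hcls).
    rewrite <- (Hrad n 0%nat) in H3; simpl Nat.add in H3; lra.
  - destruct (stage_exists rho0 delta2 l (scale t q B) Hl ltac:(lra) HS) as [n Hstage].
    destruct (floor_nat ((t / 2 * gap t q B - kappa) / l)) as [k [Hk1 Hk2]].
    { apply Rle_mult_inv_pos; unfold w in Hgw; lra. }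
    apply (Rmult_le_compat_r l) in Hk1; [| lra]. apply (Rmult_lt_compat_r l) in Hk2; [| lra].
    unfold Rdiv in Hk1, Hk2; rewrite Rmult_assoc, Rinv_l, Rmult_1_r in Hk1, Hk2 by lra.
    fold (t / 2) in Hk1, Hk2.
    assert (Hkn : (k <= n)%nat).
    (* If [n < k] then [n l < scale], so the product in [Hstage] would exceed [rho0 >= delta2]. *)
    { apply INR_le; apply (Rmult_le_reg_r l); [lra |].
      apply Rnot_lt_le; intros H.
      assert (H1 : exp (INR n * l) < exp (scale t q B)) by (apply exp_increasing; lra).
      destruct Hstage as [_ H2]; rewrite exp_Ropp in H2.
      assert (0 < exp (INR n * l)) by apply exp_pos.
      assert (H3 : 1 < / exp (INR n * l) * exp (scale t q B)).
      { apply (Rmult_lt_reg_l (exp (INR n * l))); [lra |]. field_simplify; lra. }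
      rewrite Rmult_assoc in H2. nra. }
    (* [k = 0] would put [t / 2 * gap] below [w], the case already treated. *)
    destruct k as [| k]; [simpl in Hk2; unfold w in Hgw; lra |].
    rewrite <- Hb in Hstage.
    set (a := kappa + INR (S k) * l) in *.
    assert (Hga : a <= t / 2 * gap t q B <= a + l) by (unfold a; lra).
    assert (Hcls : cls (snd (b n)) (S k) y).
    { exists q, p, r, A, B, C; repeat split; try apply Hn; try apply Hline; try apply Hstage; apply Hga. }
    destruct (Hstar n (S k) Hkn Hcls) as [y1 [H1 [H2 H3]]].
    assert (Hka : kappa <= a).
    { unfold a; assert (0 <= INR (S k)) by apply pos_INR; nra. }
    assert (Ha : 16 * M² <= exp (2 * a)).
    { eapply Rle_trans; [| apply exp_le; instantiate (1 := kappa); lra]. nra. }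
    assert (Heta : 4 * c * exp l * exp (- a) <= delta2 * exp (- (INR (S k + delay) * l))).
    { set (E := exp (- kappa - INR (S k + delay) * l)).
      replace (exp (- (INR (S k + delay) * l))) with (exp kappa * E)
        by (unfold E; rewrite <- exp_plus; f_equal; ring).
      replace (4 * c * exp l * exp (- a)) with (delta2 * (36 * M² * exp ((INR delay + 1) * l) * E)).
      - apply Rmult_le_compat_l; [lra |].
        apply Rmult_le_compat_r; [left; apply exp_pos | exact Hek].
      - rewrite <- Ed2.
        replace (4 * (9 * M² * delta2) * exp l * exp (- a)) with
          (delta2 * (36 * M² * (exp l * exp (- a)))) by ring.
        rewrite !Rmult_assoc; do 3 f_equal.
        unfold E; rewrite <- !exp_plus; f_equal; unfold a; rewrite plus_INR; ring. }
    destruct (class_close_large s t theta c l delta2 a (snd (b n)) (exp (- (INR (S k + delay) * l)))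
      y1 y q p r A B C Hs Ht Hst Hc (Rlt_le _ _ Hl) Hd2 HcM ltac:(fold M; lra) Ha Heta (Hrho n) H1 H2
      Hn Hline Hstage Hga) as [H4 | [q0 [p0 [r0 [Hq0 Hn0]]]]].
    + rewrite <- (Hrad n (S k)) in H3; lra.
    + apply (IH q0) with p0 r0; [destruct Hn0; lia | exact Hn0].
Qed.

(** * Badness from the absence of near points, and the winning strategy *)

Lemma bad_of_not_near (s t theta c y : R) : 0 < c ->
  (forall q p r : Z, ~ near s t theta c q p r y) -> Bad s t theta y.
Proof.
  intros Hc Hn; exists c; split; [exact Hc |]; intros q Hq.
  apply Rnot_lt_le; intros H; apply Rmax_Rlt in H; destruct H as [H1 H2].
  destruct (dist_nint_attained (INR q * theta)) as [p Hp].
  destruct (dist_nint_attained (INR q * y)) as [r Hr].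
  apply (Hn (Z.of_nat q) p r); rewrite <- Hp in H1; rewrite <- Hr in H2.
  rewrite INR_IZR_INZ in H1, H2; repeat split; auto; lia.
Qed.

Theorem theorem1p2 :
  forall s t theta : R,
    0 <= s -> 0 <= t -> s + t = 1 ->
    (s = 0 \/
     exists c : R, 0 < c /\
       forall q : nat, (1 <= q)%nat ->
         c <= Rpower (INR q) (1 / s) * dist_nint (INR q * theta)) ->
    alpha_winning (1 / 2) (fun y => Bad s t theta y).
Proof.
  intros s t theta Hs Ht Hst Hth beta Hbeta.
  destruct (Req_dec t 0) as [-> | Ht0].
  (* For [t = 0] the hypothesis on [theta] makes every [y] bad, so any obstacles will do. *)
  { apply (avoid_obstacles beta (fun _ _ _ => 0)); [exact Hbeta |]; intros _ y _ _ _ _.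
    replace s with 1 in * by lra.
    destruct Hth as [H | [c [Hc Hth]]]; [lra |].
    exists c; split; [exact Hc |]; intros q Hq.
    specialize (Hth q Hq); replace (1 / 1) with 1 in Hth by field.
    eapply Rle_trans; [exact Hth | apply Rmax_l]. }
  assert (Hth' : exists c0, 0 < c0 /\ (s = 0 \/ forall q : nat, (1 <= q)%nat ->
      c0 <= Rpower (INR q) (1 / s) * dist_nint (INR q * theta))).
  { destruct Hth as [H | [c [Hc Hth]]]; [exists 1; split; [lra | auto] | exists c; auto]. }
  destruct Hth' as [c0 [Hc0 Hth0]].
  (* [exp (- l) = beta / 2] is the ratio of the radii of successive balls of Bob. *)
  set (l := - ln (beta / 2)).
  assert (Hl : 0 < l).
  { assert (H : ln (beta / 2) < ln 1) by (apply ln_increasing; lra).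
    rewrite ln_1 in H; unfold l; lra. }
  assert (Hpow : forall n, (beta / 2) ^ n = exp (- (INR n * l))).
  { intros n; rewrite <- Rpower_pow by lra; unfold Rpower, l; f_equal; ring. }
  assert (Hz := fun rho0 H => avoid_near s t theta c0 rho0 l Hs ltac:(lra) Hst Hc0 Hth0 H Hl).
  (* The centres depend on Bob's first radius, which only the play reveals; [epsilon] makes them a
     function of it, while [c] stays existential. *)
  set (P := fun (rho0 : R) (z : ball -> nat -> R) => exists c : R, 0 < c /\
    forall (b : nat -> ball) (y : R),
      (forall n, snd (b n) = rho0 * exp (- (INR n * l))) ->
      (forall n, in_ball y (b n)) ->
      (forall n k, (k <= n)%nat ->
         rho0 * exp (- (INR (n + k + delay) * l)) < Rabs (y - z (b n) k)) ->
      forall q p r : Z, ~ near s t theta c q p r y).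
  apply (avoid_obstacles beta (fun rho0 => epsilon (inhabits (fun _ _ => 0)) (P rho0)));
    [exact Hbeta |].
  intros B y HB0 Hrad Hy Havoid.
  assert (HP : P (snd (B 0%nat)) (epsilon (inhabits (fun _ _ => 0)) (P (snd (B 0%nat))))).
  { apply epsilon_spec; destruct (Hz _ HB0) as [c [z H]]; exists z, c; exact H. }
  destruct HP as [c [Hc HP]]; apply (bad_of_not_near s t theta c); [exact Hc |].
  apply (HP B y).
  - intros n; now rewrite Hrad, Hpow.
  - exact Hy.
  - intros n k Hk; rewrite <- Hpow; now apply Havoid.
Qed.
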